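(* Let $s>1$. There is a constant $C_{s,n}$, depending only on $s$ and $n$ (and with $C_{s,n}\to+\infty$ when $s\to 1$), such that for every weight $w\ge 0$ on $\mathcal{H}^n$, every measurable function $f$ on $\mathcal{H}^n$ and every $\lambda>0$, $$ w\big(\{x\in \mathcal{H}^n : Mf(x)>\lambda\}\big)\le C_{s,n}\,\frac{1}{\lambda}\int_{\mathcal{H}^n}|f(x)|\,M_s w(x)\,d\mu_n(x). $$
   Context: $\mathcal{H}^n$ ($n\ge2$) denotes the $n$-dimensional hyperbolic space, i.e. the unique (up to isometries) $n$-dimensional complete simply connected Riemannian manifold of constant sectional curvature $-1$; $\mu_n$ is its volume measure, $d_n$ its distance, and $B_H(x,r)=\{y: d_n(x,y)<r\}$. The centered Hardy–Littlewood maximal function is $$Mf(x)=\sup_{r>0}\frac{1}{\mu_n(B_H(x,r))}\int_{B_H(x,r)}|f(y)|\,d\mu_n(y).$$ A weight is a non-negative measurable function $w$ on $\mathcal{H}^n$; for a measurable set $E$, $w(E)=\int_E w\,d\mu_n$. For $s>1$, $M_s w=\big(M(w^s)\big)^{1/s}$. *)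

(* Defs.v *)
From HB Require Import structures.
From mathcomp Require Import all_boot all_order all_algebra.
From mathcomp Require Import all_classical all_reals all_analysis.
From mathcomp Require Import measurable_realfun.

Set Implicit Arguments.
Unset Strict Implicit.
Unset Printing Implicit Defensive.

Import Order.TTheory GRing.Theory Num.Theory.
Import numFieldNormedType.Exports.

Local Open Scope classical_set_scope.
Local Open Scope ring_scope.

(* Lebesgue measure on R^n, by induction on n: the image of the product
   measure under the identification of R * R^n with R^(n+1). *)
Section lebesgue_cons.
Context {R : realType} (n : nat).
Local Notation tuple_ n := (n.-tuple (measurableTypeR R)).
Variable m : {sigma_finite_measure set (tuple_ n) -> \bar R}.

Definition tuple_cons (p : measurableTypeR R * tuple_ n) : tuple_ n.+1 :=
  [tuple of p.1 :: p.2].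

Lemma measurable_tuple_cons :
  measurable_fun [set: measurableTypeR R * tuple_ n] tuple_cons.
Proof. exact: measurable_cons. Qed.

Definition lebesgue_cons : set (tuple_ n.+1) -> \bar R :=
  pushforward (lebesgue_measure \x m)%E tuple_cons.

Let lebesgue_cons0 : lebesgue_cons set0 = 0%E.
Proof. by rewrite /lebesgue_cons /pushforward preimage_set0 measure0. Qed.

Let lebesgue_cons_ge0 A : (0 <= lebesgue_cons A)%E.
Proof. by rewrite /lebesgue_cons /pushforward measure_ge0. Qed.

Let lebesgue_cons_sigma_additive : semi_sigma_additive lebesgue_cons.
Proof.
move=> F mF tF mUF; rewrite /lebesgue_cons /pushforward preimage_bigcup.
apply: measure_semi_sigma_additive.
- by move=> k; rewrite -[X in measurable X]setTI; exact: measurable_tuple_cons.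
- apply/trivIsetP => /= i j _ _ ij; rewrite -preimage_setI.
  by move/trivIsetP : tF => /(_ _ _ _ _ ij) ->//; rewrite preimage_set0.
- rewrite -preimage_bigcup -[X in measurable X]setTI.
  exact: measurable_tuple_cons.
Qed.

HB.instance Definition _ := isMeasure.Build _ _ _ lebesgue_cons
  lebesgue_cons0 lebesgue_cons_ge0 lebesgue_cons_sigma_additive.

Let lebesgue_cons_sigma_finite : sigma_finite setT lebesgue_cons.
Proof.
have /sigma_finiteP[F [TF ndF Foo]] := sigma_finiteT (@lebesgue_measure R).
have /sigma_finiteP[G [TG ndG Goo]] := sigma_finiteT m.
pose u (t : tuple_ n.+1) : measurableTypeR R * tuple_ n :=
  (thead t, [tuple of behead t]).
have mu : measurable_fun setT u.
  by apply/measurable_fun_pair => /=;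
    [exact: measurable_tnth | exact: measurable_behead].
have uK p : u (tuple_cons p) = p.
  by case: p => x t; congr pair; apply/val_inj.
exists (fun k => u @^-1` (F k `*` G k)).
  rewrite -preimage_bigcup (_ : \bigcup_k _ = setT) ?preimage_setT//.
  apply/seteqP; split=> // -[x y] _.
  have [i _ Fx] : (\bigcup_k F k) x by rewrite -TF.
  have [j _ Gy] : (\bigcup_k G k) y by rewrite -TG.
  exists (maxn i j) => //; split => /=.
  - by move: x Fx; exact/subsetPset/ndF/leq_maxl.
  - by move: y Gy; exact/subsetPset/ndG/leq_maxr.
move=> k; have [mF Fk] := Foo k; have [mG Gk] := Goo k; split.
  by rewrite -[X in measurable X]setTI; apply: mu => //; exact: measurableX.
rewrite /lebesgue_cons /pushforward.
rewrite [X in (lebesgue_measure \x m)%E X](_ : _ = F k `*` G k).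
  by rewrite product_measure1E// lte_mul_pinfty// ge0_fin_numE.
rewrite -comp_preimage (_ : u \o tuple_cons = id) ?preimage_id//.
exact/funext.
Qed.

HB.instance Definition _ := Measure_isSigmaFinite.Build _ _ _
  lebesgue_cons lebesgue_cons_sigma_finite.

End lebesgue_cons.

Fixpoint lebesgue_tuple (R : realType) (n : nat) :
    {sigma_finite_measure set (n.-tuple (measurableTypeR R)) -> \bar R} :=
  match n with
  | 0 => \d_([tuple] : 0.-tuple (measurableTypeR R))
  | k.+1 => lebesgue_cons (lebesgue_tuple R k)
  end.

Notation hpoint R n :=
  (n.-1.-tuple (measurableTypeR R) * measurableTypeR R)%type.

(* The n-dimensional hyperbolic space is represented by its upper half-space
   model, the points (x, t) of R^(n-1) * R with t > 0 endowed with the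
   Riemannian metric (|dx|^2 + dt^2) / t^2. *)
Section hyperbolic_space.
Context {R : realType} (n : nat).

Local Notation point := (hpoint R n).
Local Notation lebesgue := (lebesgue_tuple R n.-1 \x lebesgue_measure)%E.

Implicit Types p q : point.

Definition halfspace : set point := [set p | 0 < (p.2 : R)].

(* Riemannian volume: the determinant of the metric is t^(-2n). *)
Definition hvol (A : set point) : \bar R :=
  (\int[lebesgue]_(p in A `&` halfspace) ((p.2 : R) ^- n)%:E)%E.

Definition sqdist p q : R :=
  \sum_(i < n.-1) ((tnth p.1 i : R) - tnth q.1 i) ^+ 2 + ((p.2 : R) - q.2) ^+ 2.

Definition arcosh (x : R) : R := ln (x + Num.sqrt (x ^+ 2 - 1)).

(* Riemannian distance:
   cosh d((x, t), (y, u)) = 1 + (|x - y|^2 + (t - u)^2) / (2 t u). *)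
Definition hdist p q : R := arcosh (1 + sqdist p q / (2 * (p.2 : R) * q.2)).

Definition hball p (r : R) : set point :=
  [set q | halfspace q /\ hdist p q < r].

Lemma measurable_halfspace : measurable halfspace.
Proof.
rewrite /halfspace (_ : [set p | _] = setT `&` snd @^-1` `]0, +oo[).
  exact: measurable_snd.
by apply/seteqP; split=> p /=; rewrite in_itv/= andbT// => -[].
Qed.

Lemma measurable_hdensity :
  measurable_fun halfspace (fun p : point => (p.2 : R) ^- n).
Proof.
apply: (eq_measurable_fun (fun p : point => (p.2 : R) `^ (- n%:R))).
  by move=> p; rewrite inE => p0; rewrite powRN powR_mulrn// ltW.
apply: measurable_funTS.
by apply: (measurableT_comp (measurable_powR _)); exact: measurable_snd.
Qed.

Let hvol0 : hvol set0 = 0%E.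
Proof. by rewrite /hvol set0I integral_set0. Qed.

Let hvol_ge0 A : (0 <= hvol A)%E.
Proof.
apply: integral_ge0 => p [_ p0].
by rewrite lee_fin invr_ge0 exprn_ge0// ltW.
Qed.

Let hvol_sigma_additive : semi_sigma_additive hvol.
Proof.
move=> F mF tF mUF; rewrite /hvol setI_bigcupl; apply: cvg_toP.
  apply: ereal_nondecreasing_is_cvgn => i j ij.
  by apply: lee_sum_nneg_natr => // k _ _; exact: hvol_ge0.
rewrite ge0_integral_bigcup//=.
- by move=> k; apply: measurableI => //; exact: measurable_halfspace.
- apply/measurable_EFinP; apply: measurable_funS measurable_hdensity.
    exact: measurable_halfspace.
  by move=> p [k _ []].
- by move=> p [k _ [_ p0]]; rewrite lee_fin invr_ge0 exprn_ge0// ltW.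
- exact: trivIset_setIr.
Qed.

HB.instance Definition _ := isMeasure.Build _ _ _
  hvol hvol0 hvol_ge0 hvol_sigma_additive.

Definition hmaximal (f : point -> R) p : \bar R :=
  ereal_sup
    [set ((hvol (hball p r))^-1 * \int[hvol]_(q in hball p r) `|f q|%:E)%E
    | r in `]0, +oo[%classic].

Definition hmaximal_pow (s : R) (w : point -> R) p : \bar R :=
  (hmaximal (fun q => (w q `^ s)%R) p `^ (s^-1)%R)%E.

Definition weight_of (w : point -> R) (E : set point) : \bar R :=
  (\int[hvol]_(p in E) (w p)%:E)%E.

End hyperbolic_space.

Arguments halfspace : clear implicits.
Arguments hvol : clear implicits.

(* Main.v *)
(** Write [nu = n - 1] and [p = (x, t)]. A ball of "radius" [delta], where
    [delta = 2 sinh (r / 2)], is [|x - y|^2 + (t - u)^2 < t u delta^2]; large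
    balls have volume about [delta^(2 nu)].

    Balls of small radius behave like Euclidean cubes of side [delta t]. By the
    one-third trick they sit in cells of finitely many dyadic grids, and maximal
    cells are disjoint, which is the classical Fefferman-Stein argument.

    For [delta^2 = 4^rho] and [t ~ 4^a], the part of the ball at height [4^b] is
    horizontally a cube [Q] of side [4^a 2^k = 4^b 2^l], with [k + l = 2 rho] up
    to constants; let [V = Q x [4^b, 4^(b+1))] and [U = Q x [4^a, 4^(a+1))], of
    volumes about [2^(nu l)] and [2^(nu k)]. If the average of [f] over the ball
    exceeds [lambda], some [b] satisfies [int_V |f| >= c lambda 2^(nu (k + l)) r^l]
    for a fixed [r < 1]. As [U] lies in a ball of volume about [2^(nu (k + l))]
    around every point of [V], Hoelder's inequality gives
    [w(U) <= C 2^(nu k) 2^(nu l / s) inf_V M_s w]. With [V] fixed, the admissible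
    [k] form a geometric progression bounded in terms of [int_V |f|], so the
    corresponding [w(U)] sum to at most
    [C / lambda * 2^(nu l / s - nu l) r^(-l) int_V |f| M_s w]. With
    [r^2 = 2^(nu (1 / s - 1))], which is where [s > 1] enters, the factor is
    [r^l]; for fixed [l] the boxes [V] tile the space, and one sums over [l]. *)
Require Import Defs.
From mathcomp Require Import all_boot all_order all_algebra.
From mathcomp Require Import all_classical all_reals all_analysis.
From mathcomp Require Import measurable_realfun.
From mathcomp Require Import ring lra zify.
Import Order.TTheory GRing.Theory Num.Theory.
Import numFieldNormedType.Exports.
Local Open Scope classical_set_scope.
Local Open Scope ring_scope.
Set Implicit Arguments.
Unset Strict Implicit.
Unset Printing Implicit Defensive.

(** * Integrals of non-negative functions *)

Section integral_bounds.
Local Open Scope ereal_scope.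
Context d (T : measurableType d) (R : realType).
Variable mu : {measure set T -> \bar R}.
Implicit Types (A B : set T) (f g h : T -> \bar R).

(* No measurability is assumed: the integral of a non-negative function is a
   supremum over the simple functions below it. *)
Lemma ge0_le_integral_subset A B f g :
  A `<=` B -> (forall x, B x -> 0 <= g x) ->
  (forall x, A x -> 0 <= f x) -> (forall x, A x -> f x <= g x) ->
  \int[mu]_(x in A) f x <= \int[mu]_(x in B) g x.
Proof.
move=> AB g0 f0 fg; rewrite !ge0_integralE//.
apply: le_ereal_sup => _ [h hf <-]; exists h => // x.
apply: (le_trans (hf x)); rewrite /patch; case: ifPn => xA; case: ifPn => xB //.
- by apply: fg; rewrite inE in xA.
- by move/negP : xB; rewrite inE; case; apply: AB; rewrite inE in xA.
- by apply: g0; rewrite inE in xB.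
Qed.

(** Disjointifying the [F k] with [seqDU] only shrinks them, so each partial sum over the disjoint
    pieces stays below [M], and so does the limit. *)
Lemma ge0_integral_bigcup_le_bound (F : (set T)^nat) f (M : \bar R) :
  (forall k, measurable (F k)) ->
  measurable_fun (\bigcup_k F k) f ->
  (forall x, (\bigcup_k F k) x -> 0 <= f x) ->
  (forall N, \sum_(0 <= k < N) \int[mu]_(x in F k) f x <= M) ->
  \int[mu]_(x in \bigcup_k F k) f x <= M.
Proof.
move=> mF mf f0 FM; rewrite seqDU_bigcup_eq ge0_integral_bigcup//; last 3 first.
- move=> k; apply: measurableD => //.
  exact: bigsetU_measurable.
- by rewrite -seqDU_bigcup_eq.
- by rewrite -seqDU_bigcup_eq.
apply: lime_le.
  apply: is_cvg_nneseries => k _ _; apply: integral_ge0 => x Fx.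
  by apply: f0; exists k => //; exact: subset_seqDU Fx.
near=> N; apply: le_trans (FM N); apply: lee_sum => k _.
apply: ge0_le_integral_subset => //.
- exact: subset_seqDU.
- by move=> x Fx; apply: f0; exists k.
- by move=> x Fx; apply: f0; exists k => //; exact: subset_seqDU Fx.
Unshelve. all: by end_near. Qed.

(** Codes that decode to nothing carry the empty set, and an initial segment of [nat] decodes to a
    duplicate-free list. *)
Lemma ge0_integral_bigcup_le_countable (I : countType) (F : I -> set T) f
    (M : \bar R) :
  (forall i, measurable (F i)) ->
  measurable_fun (\bigcup_i F i) f ->
  (forall x, (\bigcup_i F i) x -> 0 <= f x) ->
  (forall s : seq I, uniq s -> \sum_(i <- s) \int[mu]_(x in F i) f x <= M) ->
  \int[mu]_(x in \bigcup_i F i) f x <= M.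
Proof.
move=> mF mf f0 FM.
pose G k := if @pickle_inv I k is Some i then F i else set0.
have FG : \bigcup_i F i = \bigcup_k G k.
  apply/seteqP; split=> [x [i _ Fix]|x [k _]].
    by exists (pickle i) => //; rewrite /G pickleK_inv.
  by rewrite /G; case: pickle_inv => // i Fix; exists i.
rewrite FG; apply: ge0_integral_bigcup_le_bound; rewrite -?FG//.
  by move=> k; rewrite /G; case: pickle_inv.
move=> N; pose s := pmap (@pickle_inv I) (index_iota 0 N).
have us : uniq s.
  apply: (pmap_uniq (@pickle_invK I)); exact: iota_uniq.
apply: le_trans (FM s us); rewrite /s.
elim: (index_iota 0 N) => [|k r ih]; first by rewrite !big_nil.
rewrite big_cons /= /G; case: pickle_inv => [i|] /=.
  by rewrite big_cons leeD2l.
by rewrite integral_set0 add0e.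
Qed.

(* [h] need not be measurable, whence the constants [D i] below it. *)
Lemma sum_le_integral_disjoint (I : choiceType) (s : seq I) (V : I -> set T)
    (D : I -> \bar R) (H : set T) f h :
  uniq s -> measurable H ->
  (forall i, measurable (V i)) -> (forall i, V i `<=` H) -> trivIset setT V ->
  measurable_fun H f -> (forall x, H x -> 0 <= f x) ->
  (forall x, H x -> 0 <= h x) ->
  (forall i, 0 <= D i) -> (forall i x, V i x -> D i <= h x) ->
  \sum_(i <- s) D i * \int[mu]_(x in V i) f x <= \int[mu]_(x in H) (f x * h x).
Proof.
move=> us mH mV VH tV mf f0 h0 D0 Dh.
have fV0 i x : 0 <= (f \_ (V i)) x.
  by rewrite /patch; case: ifPn => // /[!inE] Vx; apply: f0; exact: VH Vx.
have mfV i : measurable_fun H (f \_ (V i)).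
  by apply/measurable_restrict => //; apply: measurable_funS mf.
have -> : \sum_(i <- s) D i * \int[mu]_(x in V i) f x =
    \int[mu]_(x in H) \sum_(i <- s) (D i * (f \_ (V i)) x).
  rewrite ge0_integral_sum//.
  - apply: eq_bigr => i _; rewrite ge0_integralZl//.
    by rewrite -integral_mkcondr setIidr.
  - by move=> i; exact: measurable_funeM.
  - by move=> i x Hx; rewrite mule_ge0.
apply: ge0_le_integral_subset => //.
- by move=> x Hx; rewrite mule_ge0 ?f0 ?h0.
- by move=> x Hx; apply: sume_ge0 => i _; rewrite mule_ge0.
(* By disjointness at most one term of the sum is non-zero at [x]. *)
move=> x Hx; elim: s us => [|i s ih] /=.
  by rewrite big_nil mule_ge0 ?f0 ?h0.
move=> /andP[is_ us]; rewrite big_cons.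
have [Vx|nVx] := pselect (V i x).
  rewrite big_seq big1 ?adde0.
    rewrite patchE mem_set// muleC lee_wpmul2l ?f0//.
    exact: Dh.
  move=> j js; rewrite patchE memNset ?mule0// => Vjx.
  have /trivIsetP/(_ i j Logic.I Logic.I) := tV.
  have -> : i != j by apply: contraNneq is_ => ->.
  move=> /(_ isT); apply/eqP/set0P; by exists x.
by rewrite patchE memNset// mule0 add0e; exact: ih.
Qed.

(** The Fefferman-Stein summation common to large and small balls: [D i] will be the infimum over
    [V i] of the maximal function [h], and the masses of [f] on the disjoint [V i] add up, while the
    [U i] may overlap. *)
Lemma integral_bigcup_le_weighted (I : countType) (U V : I -> set T)
    (D : I -> \bar R) (H : set T) (w f h : T -> \bar R) (c : R) :
  (0 <= c)%R -> measurable H ->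
  (forall i, measurable (U i)) -> (forall i, U i `<=` H) ->
  (forall i, measurable (V i)) -> (forall i, V i `<=` H) -> trivIset setT V ->
  measurable_fun H w -> (forall x, H x -> 0 <= w x) ->
  measurable_fun H f -> (forall x, H x -> 0 <= f x) ->
  (forall x, H x -> 0 <= h x) ->
  (forall i, 0 <= D i) -> (forall i x, V i x -> D i <= h x) ->
  (forall i, \int[mu]_(x in U i) w x <=
             c%:E * (D i * \int[mu]_(x in V i) f x)) ->
  \int[mu]_(x in \bigcup_i U i) w x <= c%:E * \int[mu]_(x in H) (f x * h x).
Proof.
move=> c0 mH mU UH mV VH tV mw w0 mf f0 h0 D0 Dh UV.
have UUH : \bigcup_i U i `<=` H by apply: bigcup_sub => i _; exact: UH.
apply: ge0_integral_bigcup_le_countable => //.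
- by apply: measurable_funS mw.
- by move=> x /UUH /w0.
move=> s us; apply: le_trans (lee_sum _ (fun i _ => UV i)) _.
rewrite -ge0_sume_distrr; last first.
  move=> i _; rewrite mule_ge0//; apply: integral_ge0 => x Vx.
  by apply: f0; exact: VH Vx.
by rewrite lee_wpmul2l//; apply: sum_le_integral_disjoint.
Qed.

(** Serves twice: to sum over [l] in [far_set_weight], and as a pigeonhole over heights in
    [far_set_cover]. *)
Lemma integral_bigcup_geometric (X : (set T)^nat) f (c : \bar R) (r : R) :
  (0 < r < 1)%R -> 0 <= c ->
  (forall k, measurable (X k)) ->
  measurable_fun (\bigcup_k X k) f ->
  (forall x, (\bigcup_k X k) x -> 0 <= f x) ->
  (forall k, \int[mu]_(x in X k) f x <= (r ^+ k)%:E * c) ->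
  \int[mu]_(x in \bigcup_k X k) f x <= ((1 - r)^-1)%:E * c.
Proof.
move=> /andP[r0 r1] c0 mX mf f0 Xc.
apply: ge0_integral_bigcup_le_bound => // N.
apply: (@le_trans _ _ (\sum_(0 <= k < N) (r ^+ k)%:E * c)).
  by apply: lee_sum => k _.
rewrite -ge0_sume_distrl; last by move=> k _; rewrite lee_fin exprn_ge0// ltW.
rewrite lee_wpmul2r// sumEFin lee_fin.
have : (\sum_(0 <= k < N) r ^+ k = (1 - r ^+ N) / (1 - r))%R.
  elim: N => [|N ih]; first by rewrite big_geq// expr0 subrr mul0r.
  rewrite big_nat_recr//= ih exprS; field.
  by rewrite subr_eq0 eq_sym lt_eqF.
move=> ->; rewrite -[leRHS]mul1r ler_wpM2r//.
  by rewrite invr_ge0 subr_ge0 ltW.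
by rewrite gerBl exprn_ge0// ltW.
Qed.

End integral_bounds.

(** * Volumes of boxes and balls *)

Section boxes.
Context {R : realType}.

Definition rect k (c : 'I_k -> R) (L : R) : set (k.-tuple (measurableTypeR R)) :=
  [set x | forall i, c i <= tnth x i < c i + L].

Lemma measurable_rect k (c : 'I_k -> R) L : measurable (rect c L).
Proof.
have -> : rect c L = \bigcap_(i in [set: 'I_k])
    ((fun x => tnth x i) @^-1` `[c i, c i + L[%classic).
  apply/seteqP; split=> [x xc i _|x xc i] /=; first by rewrite in_itv /= xc.
  by have := xc i Logic.I; rewrite /= in_itv.
apply: fin_bigcap_measurable => // i _.
by rewrite -[X in measurable X]setTI; exact: measurable_tnth.
Qed.

Let lebesgue_itvco (a b : R) : a <= b ->
  lebesgue_measure (`[a, b[%classic : set R) = (b - a)%:E.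
Proof.
rewrite le_eqVlt => /predU1P[->|ab].
  by rewrite set_itvco0// measure0 subrr.
by rewrite lebesgue_measure_itv/= lte_fin ab EFinB.
Qed.

Lemma lebesgue_rect k (c : 'I_k -> R) L : 0 <= L ->
  lebesgue_tuple R k (rect c L) = (L ^+ k)%:E.
Proof.
move=> L0; elim: k c => [|k ih] c.
  rewrite expr0 /= diracE mem_set; first by [].
  by case.
rewrite /= /lebesgue_cons /pushforward.
have -> : @tuple_cons R k @^-1` rect c L =
    `[c ord0, c ord0 + L[%classic `*` rect (fun i => c (lift ord0 i)) L.
  apply/seteqP; split=> [[x t] /= xc|[x t] /= [xc tc] i].
    split=> [|i]; first by rewrite in_itv/=; exact: (xc ord0).
    by have := xc (lift ord0 i); rewrite tnthS.
  case: (unliftP ord0 i) => [j ->|->]; last by rewrite in_itv in xc.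
  by rewrite tnthS.
rewrite product_measure1E//; last exact: measurable_rect.
rewrite exprS EFinM; congr (_ * _)%E; last exact: ih.
by rewrite -[in RHS](addrK (c ord0) L) [in RHS](addrC L); apply: lebesgue_itvco;
  rewrite lerDl.
Qed.

Definition box k (c : 'I_k -> R) (L al be : R) : set (hpoint R k.+1) :=
  rect c L `*` `[al, be[%classic.

Lemma boxE k (c : 'I_k -> R) (L al be : R) p :
  box c L al be p <-> (forall i, c i <= tnth p.1 i < c i + L) /\ al <= p.2 < be.
Proof. by rewrite /box /= in_itv/=. Qed.

Lemma measurable_box k (c : 'I_k -> R) (L al be : R) :
  measurable (box c L al be).
Proof. by apply: measurableX => //; exact: measurable_rect. Qed.

Lemma box_halfspace k (c : 'I_k -> R) (L al be : R) : 0 < al ->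
  box c L al be `<=` halfspace R k.+1.
Proof. by move=> al0 p /boxE[_ /andP[alp _]]; exact: lt_le_trans alp. Qed.

Let lebesgue_box k (c : 'I_k -> R) (L al be : R) : 0 <= L -> al <= be ->
  (lebesgue_tuple R k \x lebesgue_measure)%E (box c L al be) =
  (L ^+ k * (be - al))%:E.
Proof.
move=> L0 ab; rewrite product_measure1E//; last exact: measurable_rect.
rewrite EFinM; congr (_ * _)%E; last exact: lebesgue_itvco.
exact: lebesgue_rect.
Qed.

Let density_ge0 k A x : (A `&` halfspace R k.+1) x ->
  (0 <= ((x.2 : R) ^- k.+1)%:E)%E.
Proof. by move=> [_ x0]; rewrite lee_fin invr_ge0 exprn_ge0// ltW. Qed.

(** Stated for arbitrary sets because it compares boxes with balls, whose measurability is never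
    established. *)
Lemma le_hvol k (A B : set (hpoint R k.+1)) : A `&` halfspace R k.+1 `<=` B ->
  (hvol R k.+1 A <= hvol R k.+1 B)%E.
Proof.
move=> AB; apply: ge0_le_integral_subset => //; try exact: density_ge0.
by move=> x Ax; split; [exact: AB|case: Ax].
Qed.

(** The density decreases with the height, so its values at the bottom [al] and, in the next lemma,
    at the top [be] bound it on the box. *)
Lemma hvol_box_le k (c : 'I_k -> R) (L al be : R) :
  0 <= L -> 0 < al -> al <= be ->
  (hvol R k.+1 (box c L al be) <= (L ^+ k * (be - al) * al ^- k.+1)%:E)%E.
Proof.
move=> L0 al0 ab; rewrite /hvol setIidl; last exact: box_halfspace.
rewrite mulrC EFinM -(lebesgue_box c L0 ab).
rewrite -integral_cst; last exact: measurable_box.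
apply: ge0_le_integral_subset => //.
- by move=> x _; rewrite lee_fin invr_ge0 exprn_ge0// ltW.
- move=> x Bx; apply: (@density_ge0 _ (box c L al be)); split=> //.
  exact: box_halfspace Bx.
move=> x /boxE[_ /andP[ax _]]; have x0 := lt_le_trans al0 ax.
by rewrite lee_fin lef_pV2 ?posrE ?exprn_gt0// lerXn2r// nnegrE ltW.
Qed.

Lemma hvol_box_ge k (c : 'I_k -> R) (L al be : R) :
  0 <= L -> 0 < al -> al <= be ->
  ((L ^+ k * (be - al) * be ^- k.+1)%:E <= hvol R k.+1 (box c L al be))%E.
Proof.
move=> L0 al0 ab; rewrite /hvol setIidl; last exact: box_halfspace.
have be0 : 0 < be := lt_le_trans al0 ab.
rewrite mulrC EFinM -(lebesgue_box c L0 ab).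
rewrite -integral_cst; last exact: measurable_box.
apply: ge0_le_integral_subset => //.
- move=> x Bx; apply: (@density_ge0 _ (box c L al be)); split=> //.
  exact: box_halfspace Bx.
- by move=> x _; rewrite lee_fin invr_ge0 exprn_ge0// ltW.
move=> x /boxE[_ /andP[ax xb]]; have x0 := lt_le_trans al0 ax.
by rewrite lee_fin lef_pV2 ?posrE ?exprn_gt0// lerXn2r// ?nnegrE ltW.
Qed.

End boxes.

(** * Hyperbolic balls as polynomial inequalities *)

Section ball_geometry.
Context {R : realType}.

(* [hradius r = 2 sinh (r / 2)], in terms of which a ball is cut out by a
   polynomial inequality. *)
Definition hradius (r : R) : R := expR (r / 2) - expR (- (r / 2)).

Lemma hradius_gt0 r : 0 < r -> 0 < hradius r.
Proof. by move=> r0; rewrite /hradius subr_gt0 ltr_expR; lra. Qed.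

Lemma hradius_surj (d : R) : 0 < d -> exists2 r, 0 < r & hradius r = d.
Proof.
(* With [y = expR (r / 2)] the equation is [y - y^-1 = d]; this is its positive root. *)
move=> d0; pose S := Num.sqrt ((d / 2) ^+ 2 + 1); pose y := d / 2 + S.
have S0 : 0 < (d / 2) ^+ 2 + 1 by rewrite ltr_pwDr// sqr_ge0.
have y1 : 1 < y.
  rewrite /y ltr_pwDl ?divr_gt0//.
  by rewrite -{1}(@sqrtr1 R) ler_wsqrtr// lerDr sqr_ge0.
have y0 : 0 < y := lt_trans ltr01 y1.
exists (2 * ln y); first by rewrite mulr_gt0// ln_gt0.
rewrite /hradius (_ : 2 * ln y / 2 = ln y); last by field.
rewrite expRN lnK ?posrE//.
apply: (mulIf (lt0r_neq0 y0)); rewrite mulrBl mulVf ?lt0r_neq0//.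
have sq : S ^+ 2 = (d / 2) ^+ 2 + 1 by rewrite sqr_sqrtr// ltW.
have yy : y * y = y * d + 1.
  transitivity ((d / 2) ^+ 2 + d * S + S ^+ 2); first by rewrite /y; field.
  by rewrite sq /y; field.
by lra.
Qed.

(** Both sides say [z < cosh r], since [hradius r ^+ 2 = expR r + expR (- r) - 2]. The square root
    is removed by squaring [s < expR r - z]. *)
Let arcosh_lt (z r : R) : 1 <= z -> 0 < r ->
  (arcosh z < r) = (2 * (z - 1) < hradius r ^+ 2).
Proof.
move=> z1 r0; have z0 : 0 < z := lt_le_trans ltr01 z1.
set s := Num.sqrt (z ^+ 2 - 1); have s0 : 0 <= s := sqrtr_ge0 _.
have sE : s ^+ 2 = z ^+ 2 - 1.
  by rewrite sqr_sqrtr// subr_ge0 -[leLHS](expr1n _ 2) lerXn2r// nnegrE ltW.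
have zs0 : 0 < z + s by rewrite ltr_wpDr.
have -> : (arcosh z < r) = (z + s < expR r).
  by rewrite /arcosh -{1}[r]expRK ltr_ln ?posrE ?expR_gt0.
set e := expR (r / 2); have e0 : 0 < e := expR_gt0 _.
have e1 : 1 < e by rewrite /e -expR0 ltr_expR divr_gt0.
have -> : expR r = e ^+ 2 by rewrite /e -expRM_natl; congr expR; field.
rewrite /hradius -/e expRN -/e.
set f := e^-1; have ef : e * f = 1 by rewrite /f mulfV// lt0r_neq0.
have f0 : 0 < f by rewrite /f invr_gt0.
have -> : (e - f) ^+ 2 = e ^+ 2 + f ^+ 2 - 2.
  by rewrite sqrrB ef; ring.
have ee1 : 1 < e ^+ 2 by rewrite exprn_egt1.
have ff : e ^+ 2 * f ^+ 2 = 1 by rewrite -exprMn ef expr1n.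
set E := e ^+ 2 in ee1 ff *; set F := f ^+ 2 in ff *.
have F0 : 0 < F by rewrite /F exprn_gt0.
apply/idP/idP => h.
  have : s ^+ 2 < (E - z) ^+ 2 by rewrite ltrXn2r ?nnegrE ?subr_ge0//; nra.
  rewrite sE => h2.
  suff : E * (2 * z) < E * (E + F) by rewrite ltr_pM2l; [lra | lra].
  by rewrite mulrDr ff; nra.
have F1 : F < 1 by nra.
have zE : z < E by nra.
have sz : s ^+ 2 < (E - z) ^+ 2.
  rewrite sE.
  have : E * (2 * z) < E * (E + F) by rewrite ltr_pM2l; lra.
  by rewrite mulrDr ff; nra.
have {sz} : s < E - z by rewrite -(@ltr_pXn2r _ 2)// nnegrE subr_ge0 ltW.
by lra.
Qed.

Lemma sqdist_ge0 n (p q : hpoint R n) : 0 <= sqdist p q.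
Proof. by rewrite addr_ge0 ?sqr_ge0// sumr_ge0// => i _; rewrite sqr_ge0. Qed.

Lemma hballE n (p q : hpoint R n) (r : R) : halfspace R n p -> 0 < r ->
  hball p r q <->
  halfspace R n q /\ sqdist p q < p.2 * q.2 * hradius r ^+ 2.
Proof.
move=> p0 r0.
have ballE : halfspace R n q ->
    (hdist p q < r) = (sqdist p q < p.2 * q.2 * hradius r ^+ 2).
  rewrite /halfspace /= in p0 * => q0.
  rewrite /hdist arcosh_lt//; last first.
    by rewrite lerDl divr_ge0 ?sqdist_ge0// !mulr_ge0// ltW.
  have -> : 2 * (1 + sqdist p q / (2 * p.2 * q.2) - 1) =
      sqdist p q / (p.2 * q.2) by field; rewrite !lt0r_neq0.
  by rewrite ltr_pdivrMr ?mulr_gt0// mulrC.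
by rewrite /hball; split=> -[q0 pq]; split=> //; rewrite ?ballE// -ballE.
Qed.

End ball_geometry.

(** * Dyadic heights and two-sided volume bounds for balls *)

Section volume_estimates.
Context {R : realType}.

(** The ratio is [4] because a ball has horizontal extent about [sqrt (t u) d] between heights [t]
    and [u]: this is a power of [2] when [t], [u] and [d ^+ 2] are powers of [4]. *)
Definition level (a : int) : R := 4 ^ a.

Lemma level_gt0 a : 0 < level a. Proof. by rewrite /level exprz_gt0. Qed.

Lemma levelD a b : level (a + b) = level a * level b.
Proof. by rewrite /level expfzDr. Qed.

Lemma levelDn a (m : nat) : level (a + m%:Z) = level a * 4 ^+ m.
Proof. exact: levelD. Qed.

Lemma levelS a : level (a + 1) = level a * 4.
Proof. by rewrite levelD [level 1]/level expr1z. Qed.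

Lemma level_lt a b : (level a < level b) = (a < b).
Proof. by rewrite /level ltr_eXz2l// ltr1n. Qed.

Lemma level_ex (t : R) : 0 < t -> exists a, level a <= t < level (a + 1).
Proof.
move=> t0; have l4 : 0 < ln (4 : R) by rewrite ln_gt0// ltr1n.
have lE a : level a = expR (a%:~R * ln 4).
  by rewrite /level -powR_intmul ?ler0n// /powR pnatr_eq0.
exists (Num.floor (ln t / ln 4)).
rewrite !lE -[t in _ <= t < _]lnK// ler_expR ltr_expR.
by rewrite -ler_pdivlMr// -ltr_pdivrMr// floor_itv.
Qed.

(** The ball [hball p r] with [d = hradius r]; by [hradius_surj] every [d > 0] arises. *)
Definition dball n (p : hpoint R n) (d : R) : set (hpoint R n) :=
  [set q | halfspace R n q /\ sqdist p q < p.2 * q.2 * d ^+ 2].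

Lemma sqdist_coord_le n (p q : hpoint R n) i :
  (tnth p.1 i - tnth q.1 i) ^+ 2 <= sqdist p q.
Proof.
rewrite /sqdist (bigD1 i)//= -addrA lerDl addr_ge0 ?sqr_ge0//.
by apply: sumr_ge0 => j _; exact: sqr_ge0.
Qed.

Lemma sqdist_height_le n (p q : hpoint R n) : (p.2 - q.2) ^+ 2 <= sqdist p q.
Proof. by rewrite /sqdist lerDr sumr_ge0// => j _; exact: sqr_ge0. Qed.

Lemma sqdist_le n (p q : hpoint R n) (M N : R) :
  (forall i, (tnth p.1 i - tnth q.1 i) ^+ 2 <= M) -> (p.2 - q.2) ^+ 2 <= N ->
  sqdist p q <= n.-1%:R * M + N.
Proof.
move=> pM pN; rewrite /sqdist lerD//.
apply: (le_trans (ler_sum _ (fun i _ => pM i))).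
by rewrite sumr_const card_ord mulr_natl.
Qed.

(** With [t], [u] the heights of [p], [q]: if [u >= (K + 2) t] then
    [(t - u)^2 > u (u - 2 t) >= K t u]. Combined with [dball_sym] it also bounds heights from
    below. *)
Lemma dball_height_le n (p q : hpoint R n) (d K : R) : 0 <= K ->
  halfspace R n p -> d ^+ 2 <= K -> dball p d q -> q.2 < (K + 2) * p.2.
Proof.
rewrite /halfspace /= => K0 p0 dK [q0 pq]; rewrite /= in q0.
have := sqdist_height_le p q => h.
rewrite ltNge; apply/negP => c.
have tu0 : 0 < p.2 * q.2 by rewrite mulr_gt0.
have : p.2 * q.2 * d ^+ 2 <= p.2 * q.2 * K by rewrite ler_pM2l.
nra.
Qed.

Lemma dball_sym n (p q : hpoint R n) (d : R) : halfspace R n p ->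
  dball p d q -> dball q d p.
Proof.
move=> p0 [q0 pq]; split => //; rewrite mulrC in pq; rewrite mulrC.
rewrite (_ : sqdist q p = sqdist p q) ?[q.2 * p.2]mulrC//.
rewrite /sqdist -[p.2 - q.2]opprB sqrrN; congr (_ + _).
by apply: eq_bigr => i _; rewrite -[in LHS]opprB sqrrN.
Qed.

Lemma hvol_dball_ge_small k (p : hpoint R k.+1) (d : R) :
  halfspace R k.+1 p -> 0 < d <= 1 ->
  (((d / (4 * k.+1%:R)) ^+ k.+1)%:E <= hvol R k.+1 (dball p d))%E.
Proof.
move=> p0 /andP[d0 d1]; have t0 : 0 < p.2 by [].
have n0 : 0 < k.+1%:R :> R by rewrite ltr0n.
have n1 : 1 <= k.+1%:R :> R by rewrite ler1n.
(* The cube of side [e] grows upwards from [p], so that [q.2 >= t]; its squared diameter is at most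
   [k.+1 * e ^+ 2 <= (d * t / 2) ^+ 2]. *)
set t := p.2 in t0 *; set e := d * t / (2 * k.+1%:R).
have e0 : 0 < e by rewrite divr_gt0 ?mulr_gt0.
have en : e * k.+1%:R = d * t / 2 by rewrite /e; field; rewrite lt0r_neq0.
have eh : e <= d * t / 2 by rewrite -en ler_pMr.
have dt : d * t <= t by rewrite ler_piMl// ltW.
apply: (@le_trans _ _ (hvol R k.+1 (box (fun i => tnth p.1 i) e t (t + e)))).
  apply: le_trans (hvol_box_ge _ _ _ _); rewrite ?(ltW e0)//; last first.
    by rewrite lerDl ltW.
  rewrite lee_fin addrAC subrr add0r -exprSr -exprVn -exprMn.
  rewrite lerXn2r// ?nnegrE.
  - by rewrite divr_ge0 ?mulr_ge0 ?ltW.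
  - by rewrite divr_ge0 ?ltW// addr_gt0.
  rewrite ler_pdivlMr ?addr_gt0// mulrAC ler_pdivrMr ?mulr_gt0//.
  rewrite (_ : e * _ = 2 * (d * t)); last by rewrite /e; field; rewrite lt0r_neq0.
  by nra.
apply: le_hvol => q [/boxE[qx /andP[qt1 qt2]] q0]; split => //.
rewrite /= -/t in qt1 qt2 *.
have i1 i : (tnth p.1 i - tnth q.1 i) ^+ 2 <= e ^+ 2.
  by have /andP[? ?] := qx i; nra.
have i2 : (p.2 - q.2) ^+ 2 <= e ^+ 2 by rewrite -/t; nra.
apply: (le_lt_trans (sqdist_le i1 i2)).
have -> : k.+1.-1%:R * e ^+ 2 + e ^+ 2 = k.+1%:R * e ^+ 2.
  by rewrite -[k.+1%:R]natr1 mulrDl mul1r.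
have : k.+1%:R * e ^+ 2 <= (d * t / 2) * (d * t / 2).
  by rewrite expr2 mulrA [k.+1%:R * e]mulrC en ler_pM2l// divr_gt0 ?mulr_gt0.
have : 0 < d * t by rewrite mulr_gt0.
have : t * t * d ^+ 2 <= t * q.2 * d ^+ 2.
  by rewrite ler_pM2r ?exprn_gt0// ler_pM2l.
nra.
Qed.


(** A fixed fraction of the volume of a large ball lies near its bottom, at height about
    [t / d ^+ 2]: one box of horizontal side about [t] there already has volume of order
    [d ^+ (2 * k)]. *)
Lemma hvol_dball_ge_large k (p : hpoint R k.+1) (d : R) (rho : nat) :
  halfspace R k.+1 p -> (2 <= rho)%N -> 4 ^+ rho.-1 <= d ^+ 2 ->
  ((4 ^+ (rho * k) / (2 * (16 * k.+1%:R) ^+ k))%:E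
    <= hvol R k.+1 (dball p d))%E.
Proof.
move=> p0 rho2 dr; have t0 : 0 < p.2 by [].
have n0 : 0 < k.+1%:R :> R by rewrite ltr0n.
have n1 : 1 <= k.+1%:R :> R by rewrite ler1n.
set t := p.2 in t0 *; set e := t / k.+1%:R.
have e0 : 0 < e by rewrite divr_gt0.
have en : e * k.+1%:R = t by rewrite /e; field; rewrite lt0r_neq0.
set P : R := 4 ^+ rho; have P0 : 0 < P by rewrite exprn_gt0.
have P16 : 16 <= P.
  rewrite /P -(subnK rho2) exprD (_ : 4 ^+ 2 = 16 :> R); last by ring.
  by rewrite ler_peMl// exprn_ege1// ler1n.
have dP : P <= 4 * d ^+ 2.
  by rewrite /P -(prednK (ltnW rho2)) exprS ler_pM2l.
(* This height makes [t * h * d ^+ 2 >= 2 * t ^+ 2], room for a horizontal and a vertical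
   displacement of size [t]; [P >= 16] gives [2 * h <= t]. *)
set h := 8 * t / P; have h0 : 0 < h by rewrite divr_gt0 ?mulr_gt0.
have hP : h * P = 8 * t by rewrite /h; field; rewrite lt0r_neq0.
clearbody h.
apply: (@le_trans _ _
    (hvol R k.+1 (box (fun i => tnth p.1 i) e h (2 * h)))).
  apply: le_trans (hvol_box_ge _ _ _ _); rewrite ?(ltW e0)//; last first.
    by rewrite ler_peMl ?ltW// ltr1n.
  rewrite lee_fin (_ : 2 * h - h = h); last by ring.
  rewrite le_eqVlt; apply/orP; left; apply/eqP.
  rewrite exprM -/P exprMn.
  have -> : e = h * P / (8 * k.+1%:R) by rewrite hP /e; field; rewrite lt0r_neq0.
  rewrite (_ : 16 = 2 * 8) ?exprMn ?exprVn ?exprMn ?exprS; last by ring.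
  field.
  by rewrite !expf_neq0// lt0r_neq0.
apply: le_hvol => q [/boxE[qx /andP[qt1 qt2]] q0]; split => //.
rewrite /= -/t in qt1 qt2 *.
have i1 i : (tnth p.1 i - tnth q.1 i) ^+ 2 <= e ^+ 2.
  by have /andP[? ?] := qx i; nra.
have q00 : 0 < q.2 by [].
have i2 : (p.2 - q.2) ^+ 2 < t ^+ 2 by rewrite -/t; nra.
apply: (le_lt_trans (sqdist_le i1 (lexx _))).
have e1 : k.+1.-1%:R * e ^+ 2 <= t ^+ 2.
  have -> : t ^+ 2 = e ^+ 2 * k.+1%:R ^+ 2 by rewrite -exprMn en.
  rewrite mulrC ler_pM2l ?exprn_gt0//.
  apply: (@le_trans _ _ k.+1%:R); first by rewrite ler_nat.
  by rewrite expr2 ler_peMl.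
have : t * h * P <= t * q.2 * (4 * d ^+ 2).
  by rewrite ler_pM// ?ler_pM2l// ?mulr_ge0// ltW.
rewrite -mulrA hP; lra.
Qed.

Lemma hvol_dball_le_small k (p : hpoint R k.+1) (d K : R) :
  halfspace R k.+1 p -> 0 < d -> 0 <= K -> d ^+ 2 <= K ->
  (hvol R k.+1 (dball p d) <= ((2 * (K + 2) ^+ 2 * d) ^+ k.+1)%:E)%E.
Proof.
move=> p0 d0 K0 dK; have t0 : 0 < p.2 by [].
set t := p.2 in t0 *; set c := K + 2; have c2 : 2 <= c by rewrite /c; lra.
have c0 : 0 < c by lra.
set e := c * d * t; have e0 : 0 < e by rewrite !mulr_gt0.
(* The bound [t / c] controls the density, and [t - e] keeps the box of height at most [2 * e]. *)
pose al := Num.max (t / c) (t - e).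
have tc : 0 < t / c by rewrite divr_gt0.
have al0 : 0 < al by rewrite lt_max tc.
have tct : t / c <= t by rewrite ler_piMr ?(ltW t0)// invf_le1//; lra.
apply: (@le_trans _ _
    (hvol R k.+1 (box (fun i => tnth p.1 i - e) (2 * e) al (t + e)))).
  apply: le_hvol => q [pq q0].
  have := dball_height_le K0 p0 dK pq; rewrite -/c -/t => qt.
  have := dball_height_le K0 q0 dK (dball_sym p0 pq); rewrite -/c -/t => tq.
  have q00 : 0 < q.2 by [].
  have S : sqdist p q < e ^+ 2.
    apply: (lt_le_trans pq.2); rewrite -/t /e.
    have -> : (c * d * t) ^+ 2 = (t * (c * (c * t))) * d ^+ 2 by ring.
    rewrite ler_pM2r ?exprn_gt0// ler_pM2l// (le_trans (ltW qt))//.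
    by rewrite ler_pM2l// ler_peMl ?ltW//; lra.
  have lt_e (a : R) : a ^+ 2 <= sqdist p q -> - e < a < e.
    by move=> aS; have := le_lt_trans aS S => ?; apply/andP; split; nra.
  apply/boxE; split.
    move=> i; have /andP[? ?] := lt_e _ (sqdist_coord_le p q i).
    by apply/andP; split; lra.
  have := lt_e _ (sqdist_height_le p q); rewrite -/t => /andP[? ?].
  rewrite ge_max ler_pdivrMr// [q.2 * c]mulrC ltW//=.
  by apply/andP; split; lra.
have ale : al <= t + e by rewrite ge_max; apply/andP; split; lra.
apply: (le_trans (hvol_box_le _ _ _ ale)) => //; first by rewrite mulr_ge0// ltW.
rewrite lee_fin.
have -> : (2 * c ^+ 2 * d) ^+ k.+1 = (2 * e) ^+ k * (2 * e) * (t / c) ^- k.+1.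
  rewrite -exprSr -exprVn -exprMn; congr (_ ^+ _).
  by rewrite /e; field; rewrite !lt0r_neq0.
rewrite ler_pM//.
- rewrite mulr_ge0 ?exprn_ge0 ?mulr_ge0 ?(ltW e0)//; lra.
- by rewrite invr_ge0 exprn_ge0// ltW.
- rewrite ler_pM2l ?exprn_gt0 ?mulr_gt0//.
  have : t - e <= al by rewrite le_max lexx orbT.
  lra.
rewrite lef_pV2 ?posrE ?exprn_gt0// lerXn2r ?nnegrE ?(ltW tc) ?(ltW al0)//.
by rewrite le_max lexx.
Qed.

(** The ball only meets levels within [rho.+1] of [a], and [j] counts them from the lowest. At level
    [b] the squared distance is below [4^(a+1) 4^(b+1) 4^rho = (4^a 2^(j+1))^2]. *)
Lemma dball_level_cover n (p q : hpoint R n) (d : R) (rho : nat) (a : int) :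
  halfspace R n p -> level a <= p.2 < level (a + 1) ->
  d ^+ 2 <= 4 ^+ rho -> dball p d q ->
  exists2 j : nat, (j < 2 * rho + 3)%N &
    let b := a + j%:Z - rho.+1%:Z in level b <= q.2 < level (b + 1) /\
    forall i, `|tnth p.1 i - tnth q.1 i| < level a * 2 ^+ j.+1.
Proof.
move=> p0 /andP[ap pa] dr pq; have q0 : halfspace R n q := pq.1.
have t0 : 0 < p.2 by []. have u0 : 0 < q.2 by [].
have [b /andP[bq qb]] := level_ex u0.
set P : R := 4 ^+ rho in dr; have P1 : 1 <= P by rewrite exprn_ege1// ler1n.
have P0 : 0 < P by lra.
have qp := dball_height_le (ltW P0) p0 dr pq.
have {}pq' := dball_height_le (ltW P0) q0 dr (dball_sym p0 pq).
have EP : 4 ^+ rho.+2 = 16 * P by rewrite !exprS mulrA; congr (_ * _); ring.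
have [la0 lb0] := (level_gt0 a, level_gt0 b).
rewrite !levelS in pa qb.
have ab : (a < b + rho.+2%:Z)%R.
  rewrite -level_lt levelDn EP; nra.
have ba : (b < a + rho.+2%:Z)%R.
  rewrite -level_lt levelDn EP; nra.
set j := absz (b - a + rho.+1%:Z); have jE : j%:Z = b - a + rho.+1%:Z by rewrite /j; clear - ab ba; lia.
exists j; first by clear - jE ab ba; clearbody j; lia.
rewrite /= jE (_ : a + _ - _ = b); last by ring.
rewrite levelS bq qb; split=> // i.
have lj : level a * 4 ^+ j = level b * (4 * P).
  by rewrite -exprS -!levelDn; congr level; clear - jE; clearbody j; lia.
rewrite -(@ltr_pXn2r _ 2) ?nnegrE ?mulr_ge0 ?exprn_ge0 ?(ltW la0)//.
rewrite real_normK ?num_real//; apply: le_lt_trans (sqdist_coord_le p q i) _.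
apply: (lt_le_trans pq.2).
have -> : (level a * 2 ^+ j.+1) ^+ 2 = (level a * 4) * (level a * 4 ^+ j).
  rewrite [2 ^+ j.+1]exprS (_ : 4 ^+ j = (2 ^+ j) ^+ 2); first by ring.
  by rewrite -exprM mulnC exprM; congr (_ ^+ _); ring.
rewrite lj.
have : p.2 * q.2 * d ^+ 2 <= (level a * 4) * (level b * 4) * P.
  rewrite ler_pM ?sqr_ge0 ?mulr_ge0 ?(ltW t0) ?(ltW u0)//.
  by rewrite ler_pM ?(ltW t0) ?(ltW u0) ?(ltW pa) ?(ltW qb)//; lra.
lra.
Qed.

End volume_estimates.

Section level_boxes.
Context {R : realType}.

Definition level_box k (c : 'I_k -> R) (L : R) (b : int) : set (hpoint R k.+1) :=
  box c L (level b) (level (b + 1)).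

Lemma hvol_level_box_le k (c : 'I_k -> R) (X : R) b : 0 <= X ->
  (hvol R k.+1 (level_box c (level b * X) b) <= (3 * X ^+ k)%:E)%E.
Proof.
move=> X0; have l0 := level_gt0 b (R := R).
apply: (le_trans (hvol_box_le _ _ _ _)) => //; first by rewrite mulr_ge0// ltW.
  by rewrite levelS; lra.
rewrite lee_fin levelS exprMn exprSr le_eqVlt; apply/orP; left; apply/eqP.
by field; rewrite ?expf_neq0 lt0r_neq0.
Qed.

Lemma sum_half_le (N : nat) : \sum_(j < N) (1 / 2 : R) ^+ j <= 2.
Proof.
suff -> : \sum_(j < N) (1 / 2 : R) ^+ j = 2 - 2 * (1 / 2) ^+ N.
  by rewrite gerBl mulr_ge0 ?exprn_ge0//; lra.
elim: N => [|N ih]; first by rewrite big_ord0 expr0; lra.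
by rewrite big_ord_recr/= ih exprS; field.
Qed.

(** The pieces given by [dball_level_cover] have volumes decaying geometrically from the bottom of
    the ball upwards, at rate [2 ^- k <= 1 / 2] per level. *)
Lemma hvol_dball_le_large k (p : hpoint R k.+1) (d : R) (rho : nat) :
  (0 < k)%N -> halfspace R k.+1 p -> d ^+ 2 <= 4 ^+ rho ->
  (hvol R k.+1 (dball p d) <= (6 * 16 ^+ k * 4 ^+ (rho * k))%:E)%E.
Proof.
move=> k0 p0 dr; have t0 : 0 < p.2 by [].
have [a ap] := level_ex t0; have la0 := level_gt0 a (R := R).
pose b (j : nat) := a + j%:Z - rho.+1%:Z.
pose B (j : nat) := level_box (fun i => tnth p.1 i - level a * 2 ^+ j.+1)
  (level (b j) * (16 * 4 ^+ rho * (1 / 2) ^+ j)) (b j).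
have lb j : level (b j) * (16 * 4 ^+ rho * (1 / 2) ^+ j) = 2 * (level a * 2 ^+ j.+1) :> R.
  have : level (b j) * (4 * 4 ^+ rho) = level a * 4 ^+ j :> R.
    by rewrite -(exprS 4 rho) -!levelDn /b; congr level; ring.
  have E2 : (2 : R) ^+ j = 4 ^+ j * (1 / 2) ^+ j.
    by rewrite -exprMn; congr (_ ^+ _); field.
  move=> E; rewrite exprS E2.
  have -> : level (b j) * (16 * 4 ^+ rho * (1 / 2) ^+ j) =
    4 * (level (b j) * (4 * 4 ^+ rho)) * (1 / 2) ^+ j :> R by ring.
  by rewrite E; ring.
apply: (@le_trans _ _ (hvol R k.+1 (\big[setU/set0]_(j < 2 * rho + 3) B j))).
  apply: le_hvol => q [pq _].
  have [j jr [qb qi]] := dball_level_cover p0 ap dr pq.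
  rewrite -bigcup_mkord; exists j => //.
  apply/boxE; split=> // i; rewrite lb.
  by have := qi i; rewrite ltr_norml => /andP[? ?]; apply/andP; split; lra.
apply: (le_trans (Boole_inequality _ _)).
  by move=> i _; exact: measurable_box.
apply: (@le_trans _ _ (\sum_(j < 2 * rho + 3)
    (3 * (16 * 4 ^+ rho) ^+ k * (1 / 2) ^+ j)%:E)%E).
  apply: lee_sum => j _; apply: (le_trans (hvol_level_box_le _ _ _)).
    by rewrite !mulr_ge0 ?exprn_ge0//; lra.
  rewrite lee_fin exprMn mulrA ler_pM2l; last first.
    by rewrite mulr_gt0// exprn_gt0// mulr_gt0// exprn_gt0.
  rewrite -exprM ler_wiXn2l ?leq_pmulr//; lra.
rewrite sumEFin lee_fin -mulr_sumr exprMn -exprM.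
have := sum_half_le (2 * rho + 3).
have : 0 < 16 ^+ k * 4 ^+ (rho * k) :> R by rewrite mulr_gt0 ?exprn_gt0.
nra.
Qed.

End level_boxes.
Arguments level_box {R k}.

(** * Averages of the weight *)

Section weights.
Context {R : realType}.

(* [tau] is later taken close to the [L^s] average of [w]; this replaces
   Hoelder's inequality at the price of a factor [2]. *)
Let young (x tau s : R) : 0 <= x -> 0 < tau -> 1 < s ->
  x <= tau + tau `^ (1 - s) * x `^ s.
Proof.
move=> x0 t0 s1; have [xt|tx] := leP x tau.
  by rewrite (le_trans xt)// lerDl mulr_ge0 ?powR_ge0.
have {}x0 : 0 < x := lt_trans t0 tx.
apply: (@le_trans _ _ (tau `^ (1 - s) * x `^ s)); last by rewrite lerDr ltW.
have {1}-> : x = x `^ (1 - s) * x `^ s.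
  by rewrite -powRD ?subrK ?powRr1 ?ltW// lt0r_neq0// implybT.
rewrite ler_pM2r ?powR_gt0// -opprB !powRN lef_pV2 ?posrE ?powR_gt0//.
by apply: ge0_ler_powR; rewrite ?nnegrE ?subr_ge0 ltW.
Qed.

(** Here [A] bounds the ratio of the volume of the ball to the bound [v] for [U]. Integrating
    [young] over [U] gives [tau * v] plus a term controlled by the average of [w ^ s] over the
    ball. *)
Lemma integral_le_hmaximal_pow n (s : R) (w : hpoint R n -> R)
    (U : set (hpoint R n)) (q : hpoint R n) (d v A : R) :
  1 < s -> measurable_fun (halfspace R n) w ->
  (forall p, halfspace R n p -> 0 <= w p) ->
  measurable U -> halfspace R n q -> 0 < d -> U `<=` dball q d ->
  0 < v -> 0 < A -> (hvol R n U <= v%:E)%E ->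
  (0 < hvol R n (dball q d))%E -> (hvol R n (dball q d) <= (A * v)%:E)%E ->
  (\int[hvol R n]_(p in U) (w p)%:E <=
    (2 * v * A `^ s^-1)%:E * hmaximal_pow s w q)%E.
Proof.
move=> s1 mw w0 mU q0 d0 Ud v0 A0 Uv B0 BA.
have s0 : 0 < s := lt_trans ltr01 s1.
have UH : U `<=` halfspace R n by move=> x /Ud [].
have [r r0 rd] := hradius_surj d0.
have BE : hball q r = dball q d.
  by apply/seteqP; split=> x; rewrite hballE// /dball rd.
rewrite /hmaximal_pow; set m := hmaximal _ q.
set I := (\int[hvol R n]_(p in dball q d) `|w p `^ s|%:E)%E.
have I0 : (0 <= I)%E by apply: integral_ge0.
have Im : (I <= (A * v)%:E * m)%E.
  have : ((hvol R n (dball q d))^-1 * I <= m)%E.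
    by apply: ereal_sup_ubound; exists r; [rewrite /= in_itv/= r0|rewrite BE].
  move: B0 BA; case: (hvol R n (dball q d)) => // b b0 bA.
  rewrite lte_fin in b0; rewrite lee_fin in bA.
  rewrite inver (negbTE (lt0r_neq0 b0)) => h.
  have m0 : (0 <= m)%E.
    by apply: le_trans h; rewrite mule_ge0// lee_fin invr_ge0 ltW.
  apply: (@le_trans _ _ (b%:E * m)%E); last by rewrite lee_wpmul2r.
  rewrite -(@lee_pmul2l _ (b^-1%:E)) ?lte_fin ?invr_gt0// muleA -EFinM mulVf.
    by rewrite mul1e.
  by rewrite lt0r_neq0.
have UI : (\int[hvol R n]_(p in U) (w p `^ s)%:E <= I)%E.
  apply: ge0_le_integral_subset => //.
  - by move=> x Ux; rewrite lee_fin powR_ge0.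
  - by move=> x Ux; rewrite lee_fin ler_norm.
have C0 : 0 < 2 * v * A `^ s^-1 by rewrite !mulr_gt0// powR_gt0.
move: Im; case: m => [m| |] Im; last 2 first.
- by rewrite poweRyr ?invr_eq0 ?lt0r_neq0// gt0_muley ?leey// lte_fin.
- by have := le_trans I0 Im; rewrite gt0_muleNy ?lte_fin ?mulr_gt0.
have m0 : 0 <= m.
  by have := le_trans I0 Im; rewrite -EFinM lee_fin pmulr_rge0// mulr_gt0.
rewrite poweR_EFin -EFinM.
(* Both terms are at most [v * tau] as soon as [tau ^ s] dominates [A * m]. *)
have key (tau : R) : 0 < tau -> A * m <= tau `^ s ->
    (\int[hvol R n]_(p in U) (w p)%:E <= (2 * v * tau)%:E)%E.
  move=> t0 At.
  apply: (@le_trans _ _ (\int[hvol R n]_(p in U)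
      (tau%:E + (tau `^ (1 - s))%:E * (w p `^ s)%:E))%E).
    apply: ge0_le_integral_subset => //.
    - move=> x Ux; rewrite -EFinM -EFinD lee_fin.
      by rewrite addr_ge0 ?mulr_ge0 ?powR_ge0 ?ltW.
    - by move=> x Ux; rewrite lee_fin w0//; exact: UH.
    - by move=> x Ux; rewrite -EFinM -EFinD lee_fin young// w0//; exact: UH.
  have mws : measurable_fun U (fun x => (w x `^ s)%:E).
    apply/measurable_EFinP.
    apply: (measurableT_comp (measurable_powR s)).
    by apply: measurable_funS mw => //; exact: measurable_halfspace.
  rewrite ge0_integralD//=; last 3 first.
  - by move=> x _; rewrite lee_fin ltW.
  - by move=> x _; rewrite -EFinM lee_fin mulr_ge0 ?powR_ge0.
  - exact: measurable_funeM.
  rewrite integral_cst// ge0_integralZl//; last 2 first.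
  - by move=> x _; rewrite lee_fin powR_ge0.
  - by rewrite lee_fin powR_ge0.
  apply: (@le_trans _ _ (tau%:E * v%:E + (tau `^ (1 - s))%:E * (A * v * m)%:E)%E).
    apply: leeD; first by rewrite lee_wpmul2l// lee_fin ltW.
    rewrite lee_wpmul2l ?lee_fin ?powR_ge0// EFinM.
    exact: le_trans UI Im.
  rewrite -!EFinM -EFinD lee_fin.
  have : tau `^ (1 - s) * (A * m) <= tau.
    have {2}-> : tau = tau `^ (1 - s) * tau `^ s.
      by rewrite -powRD ?subrK ?powRr1 ?ltW// lt0r_neq0// implybT.
    by rewrite ler_pM2l ?powR_gt0.
  nra.
apply/lee_addgt0Pr => e e0.
have Am0 : 0 <= A * m by rewrite mulr_ge0// ltW.
(* The root vanishes when [m = 0], hence the positive correction, which costs [e] in the final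
   bound. *)
pose tau := (A * m) `^ s^-1 + e / (2 * v).
have tm : (A * m) `^ s^-1 < tau by rewrite ltrDl divr_gt0 ?mulr_gt0.
have t0 : 0 < tau by apply: le_lt_trans tm; exact: powR_ge0.
apply: (le_trans (key tau t0 _)).
  rewrite -[leLHS]powRr1// -(mulVf (lt0r_neq0 s0)) powRrM.
  by rewrite ge0_ler_powR ?nnegrE ?powR_ge0 ?ltW.
rewrite -EFinD lee_fin /tau powRM ?(ltW A0)// le_eqVlt; apply/orP; left; apply/eqP.
by field; rewrite lt0r_neq0.
Qed.

End weights.

(** * Shifted dyadic grids *)

Section grids.
Context {R : realType}.

Let floor_stable (x y : R) : (forall j : int, 6^-1 <= `|x - j%:~R|) ->
  `|y - x| < 6^-1 -> Num.floor y = Num.floor x.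
Proof.
move=> xj yx; apply: floor_def.
have /andP[fx xf] := floor_itv x; rewrite intrD in xf *.
set f := (Num.floor x)%:~R in fx xf *.
have h1 : 6^-1 <= x - f by rewrite -[leRHS]ger0_norm ?subr_ge0//; exact: xj.
have h2 : 6^-1 <= f + 1 - x.
  rewrite -[leRHS]ger0_norm ?subr_ge0 ?(ltW xf)// distrC /f.
  have := xj (Num.floor x + 1); by rewrite intrD.
by move: yx; rewrite ltr_norml => /andP[? ?]; apply/andP; split; lra.
Qed.

(* The one-third trick: [2 ^ m / 3] stays at distance at least [1 / 3] from the
   integers, so the grid and its translate by [1 / 3] cannot both separate
   close points, whatever the level [m]. *)
Lemma one_third_grid (m : nat) (x : R) : exists e : bool, forall y,
  `|y - x| * 2 ^+ m < 6^-1 ->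
  Num.floor (2 ^+ m * (y + e%:R / 3)) = Num.floor (2 ^+ m * (x + e%:R / 3)).
Proof.
have p0 : 0 < 2 ^+ m :> R by rewrite exprn_gt0.
have near (e : bool) :
    (forall j : int, 6^-1 <= `|2 ^+ m * (x + e%:R / 3) - j%:~R|) ->
    forall y, `|y - x| * 2 ^+ m < 6^-1 ->
    Num.floor (2 ^+ m * (y + e%:R / 3)) = Num.floor (2 ^+ m * (x + e%:R / 3)).
  move=> xj y yx; apply: floor_stable => //.
  rewrite -mulrBr opprD addrACA subrr addr0 normrM mulrC.
  by rewrite (gtr0_norm p0).
have [h0|/existsNP[j /negP]] :=
    pselect (forall j : int, 6^-1 <= `|2 ^+ m * (x + false%:R / 3) - j%:~R|).
  by exists false; exact: near.
rewrite -ltNge => hj.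
have [h1|/existsNP[i /negP]] :=
    pselect (forall j : int, 6^-1 <= `|2 ^+ m * (x + true%:R / 3) - j%:~R|).
  by exists true; exact: near.
rewrite -ltNge => hi; exfalso.
have : `|(2 ^+ m - 3 * (i - j))%:~R : R| < 1.
  have -> : (2 ^+ m - 3 * (i - j))%:~R = 2 ^+ m - 3 * (i%:~R - j%:~R) :> R.
    by rewrite rmorphB rmorphM rmorphB rmorphXn.
  move: hj hi; rewrite /= mul0r addr0 !ltr_norml.
  move: (2 ^+ m) => P /andP[? ?] /andP[? ?].
  by apply/andP; split; lra.
rewrite -intr_norm -[1]/(1%:~R) ltr_int => h.
have {}h : 2 ^+ m = 3 * (i - j) :> int by lia.
have : (3 %| 2 ^+ m)%Z by rewrite h dvdz_mulr.
by rewrite dvdzE abszX Euclid_dvdX.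
Qed.

(** The shift [h / 3] is the same for every [m], which makes the grids with given [h] and [e]
    nested; in units of the mesh it is [2 ^+ m / 3]. *)
Definition grid_corner (h : R) (m : nat) (e : bool) (z : int) : R :=
  h / 2 ^+ m * z%:~R - h * (e%:R / 3).

Lemma grid_cornerP (h : R) (m : nat) (e : bool) (z : int) (y : R) : 0 < h ->
  (grid_corner h m e z <= y < grid_corner h m e z + h / 2 ^+ m) =
  (Num.floor (2 ^+ m * (y / h + e%:R / 3)) == z).
Proof.
move=> h0; have p0 : 0 < 2 ^+ m :> R by rewrite exprn_gt0.
have hm0 : 0 < h / 2 ^+ m by rewrite divr_gt0.
rewrite real_floor_eq ?num_real// intrD.
set X := 2 ^+ m * _.
have yE : y = h / 2 ^+ m * X - h * (e%:R / 3).
  by rewrite /X; field; rewrite !lt0r_neq0.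
rewrite {1 2}yE /grid_corner lerD2r ler_pM2l//.
by rewrite addrAC ltrD2r -[X in _ + X]mulr1 -mulrDr ltr_pM2l.
Qed.

Lemma grid_corner_ex (h : R) (m : nat) (x : R) : 0 < h ->
  exists ez : bool * int, forall y, `|y - x| * (6 * 2 ^+ m) < h ->
  grid_corner h m ez.1 ez.2 <= y < grid_corner h m ez.1 ez.2 + h / 2 ^+ m.
Proof.
move=> h0; have [e he] := one_third_grid m (x / h).
exists (e, Num.floor (2 ^+ m * (x / h + e%:R / 3))) => y yx.
rewrite grid_cornerP//=; apply/eqP/he.
rewrite -mulrBl normrM (gtr0_norm (_ : 0 < h^-1)) ?invr_gt0//.
rewrite mulrAC ltr_pdivrMr// -subr_gt0.
by move: yx; rewrite -subr_gt0; lra.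
Qed.

(** Each coordinate has its own shift, whence [2 ^ k] grids. *)
Definition grid_cell k (h : R) (m : nat) (e : {ffun 'I_k -> bool})
    (z : {ffun 'I_k -> int}) : 'I_k -> R :=
  fun i => grid_corner h m (e i) (z i).

Lemma grid_cell_ex k (h : R) (m : nat) (x : 'I_k -> R) : 0 < h ->
  exists e z, forall y : 'I_k -> R,
  (forall i, `|y i - x i| * (6 * 2 ^+ m) < h) ->
  forall i, grid_cell h m e z i <= y i < grid_cell h m e z i + h / 2 ^+ m.
Proof.
move=> h0; have /choice[ez hez] := fun i => grid_corner_ex m (x i) h0.
exists (finfun (fun i => (ez i).1)), (finfun (fun i => (ez i).2)) => y yx i.
by rewrite /grid_cell !ffunE; apply: hez.
Qed.

Lemma grid_cell_inj k (h : R) (m : nat) e z z' (y : 'I_k -> R) : 0 < h ->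
  (forall i, grid_cell h m e z i <= y i < grid_cell h m e z i + h / 2 ^+ m) ->
  (forall i, grid_cell h m e z' i <= y i < grid_cell h m e z' i + h / 2 ^+ m) ->
  z = z'.
Proof.
move=> h0 yz yz'; apply/ffunP => i.
move: (yz i) (yz' i); rewrite /grid_cell !grid_cornerP//.
by move=> /eqP <- /eqP <-.
Qed.

End grids.


(** * Large balls *)

Section far_tools.
Context {R : realType}.

Lemma hvol_dball_mono k (p : hpoint R k.+1) (d d' : R) :
  halfspace R k.+1 p -> 0 <= d <= d' ->
  (hvol R k.+1 (dball p d) <= hvol R k.+1 (dball p d'))%E.
Proof.
move=> p0 /andP[d0 dd']; apply: le_hvol => q [[q0 pq] _]; split => //.
apply: (lt_le_trans pq); rewrite ler_pM2l ?mulr_gt0//.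
by rewrite lerXn2r// nnegrE (le_trans d0).
Qed.

Lemma hvol_dball_gt0 k (p : hpoint R k.+1) (d : R) :
  halfspace R k.+1 p -> 0 < d -> (0 < hvol R k.+1 (dball p d))%E.
Proof.
move=> p0 d0; pose e := Num.min d 1.
have e0 : 0 < e by rewrite lt_min d0 ltr01.
apply: (@lt_le_trans _ _ (hvol R k.+1 (dball p e))); last first.
  by apply: hvol_dball_mono => //; rewrite ltW//= ge_min lexx.
apply: lt_le_trans (hvol_dball_ge_small p0 _).
  by rewrite lte_fin exprn_gt0// divr_gt0// mulr_gt0.
by rewrite e0 ge_min lexx orbT.
Qed.

(** For [rho < 2] the ball of radius [d0] inside suffices, the constant absorbing
    [4 ^+ (rho * k) <= 4 ^+ k]. *)
Lemma hvol_dball_ge_far k (d0 : R) : 0 < d0 <= 1 ->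
  exists2 c : R, 0 < c & forall (p : hpoint R k.+1) (d : R) (rho : nat),
  halfspace R k.+1 p -> d0 <= d -> ((2 <= rho)%N -> 4 ^+ rho.-1 <= d ^+ 2) ->
  ((c * 4 ^+ (rho * k))%:E <= hvol R k.+1 (dball p d))%E.
Proof.
move=> /andP[d0_gt0 d01].
pose c1 : R := (d0 / (4 * k.+1%:R)) ^+ k.+1 / 4 ^+ k.
pose c2 : R := (2 * (16 * k.+1%:R) ^+ k)^-1.
have c10 : 0 < c1.
  by rewrite divr_gt0 ?exprn_gt0// divr_gt0// mulr_gt0.
have c20 : 0 < c2 by rewrite invr_gt0 mulr_gt0// exprn_gt0// mulr_gt0.
exists (Num.min c1 c2) => [|p d rho p0 dd dr]; first by rewrite lt_min c10.
have [r2|r2] := leqP 2 rho.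
  apply: le_trans (hvol_dball_ge_large p0 r2 (dr r2)).
  by rewrite lee_fin mulrC ler_pM2l ?exprn_gt0// ge_min lexx orbT.
apply: (@le_trans _ _ (hvol R k.+1 (dball p d0))); last first.
  by apply: hvol_dball_mono; rewrite ?(ltW d0_gt0).
apply: le_trans (hvol_dball_ge_small p0 _); last by rewrite d0_gt0.
rewrite lee_fin; apply: (@le_trans _ _ (c1 * 4 ^+ k)); last first.
  by rewrite /c1 divfK// expf_neq0.
rewrite ler_pM ?exprn_ge0//.
- by rewrite le_min !ltW.
- by rewrite ge_min lexx.
- by rewrite ler_weXn2l ?ler1n// -[leqRHS]mul1n leq_mul2r -ltnS r2 orbT.
Qed.

Lemma far_scale (d : R) : exists2 rho : nat, d ^+ 2 <= 4 ^+ rho &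
  ((2 <= rho)%N -> 4 ^+ rho.-1 <= d ^+ 2).
Proof.
have ex : exists rho, d ^+ 2 <= 4 ^+ rho.
  have [N dN] : exists N : nat, d ^+ 2 <= N%:R.
    exists (Num.bound (d ^+ 2)); rewrite ltW//.
    by apply: archi_boundP; rewrite sqr_ge0.
  exists N; apply: (le_trans dN); rewrite -natrX ler_nat.
  by rewrite ltnW// ltn_expl.
exists (ex_minn ex); first by case: ex_minnP.
case: ex_minnP => rho dr rmin r2.
rewrite leNgt; apply/negP => /ltW /rmin.
by case: rho r2 {dr rmin} => // rho _; rewrite ltnn.
Qed.

(* The sum is dominated by its last term, as the [b i] at least double. *)
Lemma sum_doubling_le (b : nat -> R) (F : \bar R) (N : nat) :
  (forall i, 0 < b i) -> (forall i, 2 * b i <= b i.+1) -> (0 <= F)%E ->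
  (\sum_(0 <= i < N | ((b i)%:E <= F)%E) (b i)%:E <= 2%:E * F)%E.
Proof.
move=> b0 bS F0.
suff [] : (\sum_(0 <= i < N | (b i)%:E <= F) (b i)%:E <= (b N)%:E /\
  \sum_(0 <= i < N | (b i)%:E <= F) (b i)%:E <= 2%:E * F)%E by [].
elim: N => [|N [ih1 ih2]].
  by rewrite big_geq//; split; [rewrite lee_fin ltW|rewrite mule_ge0].
rewrite big_mkcond big_nat_recr//= -big_mkcond; case: ifPn => bF.
  split.
    apply: (@le_trans _ _ ((b N)%:E + (b N)%:E)%E); first by rewrite leeD2r.
    by rewrite -EFinD lee_fin; have := bS N; lra.
  rewrite (_ : 2%:E * F = F + F)%E; last by rewrite mule_natl mule2n.
  by apply: leeD => //; exact: le_trans ih1 bF.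
rewrite adde0; split=> //; apply: (le_trans ih1).
by rewrite lee_fin; have := bS N; have := b0 N; lra.
Qed.

Lemma integral_bigcup_finite d (T : measurableType d)
    (mu : {measure set T -> \bar R}) (I : finType) (F : I -> set T)
    (f : T -> \bar R) (M : \bar R) :
  (forall i, measurable (F i)) ->
  measurable_fun (\bigcup_i F i) f ->
  (forall x, (\bigcup_i F i) x -> 0 <= f x)%E ->
  (0 <= M)%E ->
  (forall i, \int[mu]_(x in F i) f x <= M)%E ->
  (\int[mu]_(x in \bigcup_i F i) f x <= #|I|%:R%:E * M)%E.
Proof.
move=> mF mf f0 M0 FM; apply: ge0_integral_bigcup_le_countable => // s us.
apply: (@le_trans _ _ ((size s)%:R%:E * M)%E); last first.
  by rewrite lee_wpmul2r// lee_fin ler_nat -(card_uniqP us) max_card.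
elim: s {us} => [|i s ih]; first by rewrite big_nil mule_ge0.
rewrite big_cons /= -natr1 EFinD ge0_muleDl ?lee_fin// mul1e addeC.
exact: leeD.
Qed.

End far_tools.

(** * The boxes [V] carrying [f] and the boxes [U] they control *)

Section far_part.
Context {R : realType} (k : nat).
Local Notation point := (hpoint R k.+1).
Local Notation H := (halfspace R k.+1).
Local Notation mu := (hvol R k.+1).

Definition far_corner (l : nat) e (bz : int * {ffun 'I_k -> int}) : 'I_k -> R :=
  grid_cell (level bz.1 * 2 ^+ l) 0 e bz.2.

Definition far_target l e bz : set point :=
  level_box (far_corner l e bz) (level bz.1 * 2 ^+ l) bz.1.

(* The boxes above and below [far_target l e bz] of height [4 ^ a], indexed by
   [i] in such a way that their horizontal side is [4 ^ a * 2 ^ (odd l + 2 i)]. *)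
Definition far_source l e bz (i : nat) : set point :=
  level_box (far_corner l e bz) (level bz.1 * 2 ^+ l) (bz.1 + l./2%:Z - i%:Z).

(** Lowering the level by one multiplies the side, in units of the height, by [4 = 2 ^+ 2]; so the
    exponent keeps the parity of [l]. *)
Lemma far_side (b : int) (l i : nat) :
  level b * 2 ^+ l = level (b + l./2%:Z - i%:Z) * 2 ^+ (odd l + i.*2) :> R.
Proof.
have two4 j : (2 : R) ^+ j.*2 = 4 ^+ j.
  by rewrite -mul2n exprM; congr (_ ^+ _); ring.
rewrite -{1}(odd_double_half l) !exprD !two4 mulrCA [RHS]mulrCA -!levelDn.
by congr (_ * level _); ring.
Qed.

Lemma far_exponentD (l i : nat) : (odd l + i.*2 + l = 2 * (i + uphalf l))%N.
Proof. by rewrite -{2}(odd_double_half l) uphalf_half; lia. Qed.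

(** The common side satisfies [L^2 = 4^a 4^b 4^(i + uphalf l)] and both heights are below [4 L], so
    squared distances are at most [(k + 16) L^2]; the summand [k + 16] in the exponent absorbs that
    factor. *)
Lemma far_source_sub_dball l e bz i q :
  far_target l e bz q ->
  far_source l e bz i `<=` dball q (2 ^+ (i + uphalf l + (k + 16))).
Proof.
case: bz => b z /boxE /= [qx /andP[q1 q2]] p /boxE /=.
set a := b + _ - _ => -[px /andP[p1 p2]].
have [la0 lb0] := (level_gt0 a (R := R), level_gt0 b (R := R)).
split; first exact: lt_le_trans p1.
have := far_side b l i; rewrite -/a; set L := level b * 2 ^+ l => La.
have L2 : L ^+ 2 = level a * level b * 4 ^+ (i + uphalf l).
  rewrite expr2 {1}La /L mulrACA; congr (_ * _).
  by rewrite -exprD far_exponentD exprM; congr (_ ^+ _); ring.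
have Lb : level b <= L by rewrite /L ler_peMr ?(ltW lb0)// exprn_ege1// ler1n.
have aL : level a <= L by rewrite La ler_peMr ?(ltW la0)// exprn_ege1// ler1n.
rewrite levelS in p2; rewrite levelS in q2.
have xi j : (tnth q.1 j - tnth p.1 j) ^+ 2 <= L ^+ 2.
  have := qx j; have := px j; rewrite -/L => /andP[? ?] /andP[? ?].
  by nra.
have ti : (q.2 - p.2) ^+ 2 <= 16 * L ^+ 2.
  clear - la0 lb0 p1 p2 q1 q2 Lb aL; clearbody L.
  have h1 : q.2 - p.2 < 4 * L by lra.
  have h2 : p.2 - q.2 < 4 * L by lra.
  by clear - h1 h2; nra.
apply: (le_lt_trans (sqdist_le xi ti)); rewrite /= -mulrDl.
have -> : (2 : R) ^+ (i + uphalf l + (k + 16)) ^+ 2 =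
    4 ^+ (i + uphalf l) * 4 ^+ (k + 16).
  by rewrite -exprM mulnC exprM -exprD; congr (_ ^+ _); ring.
rewrite L2 mulrCA mulrA; set S := 4 ^+ (i + _).
have S0 : 0 < S :> R by rewrite exprn_gt0.
have tu : level a * level b <= q.2 * p.2 by rewrite mulrC ler_pM// ltW.
apply: (@lt_le_trans _ _ (level a * level b * S * 4 ^+ (k + 16))); last first.
  by rewrite mulrA ler_pM2r ?exprn_gt0// ler_pM2r.
rewrite mulrAC ltr_pM2l ?mulr_gt0//.
by rewrite -natrX -natrD ltr_nat ltn_expl.
Qed.

Variable s : R.
Hypotheses (k_gt0 : (0 < k)%N) (s_gt1 : 1 < s).

(* Chosen so that [2 ^ (k l / s) = 2 ^ (k l) * far_ratio ^ (2 l)]: one factor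
   [far_ratio ^ l] is spent on the pigeonhole over heights, the other is summed. *)
Definition far_ratio : R := 2 `^ (k%:R * (s^-1 - 1) / 2).

(** The exponent is negative since [s > 1] and [k > 0]; all geometric sums over [l] rest on this. *)
Lemma far_ratio_itv : 0 < far_ratio < 1.
Proof.
rewrite powR_gt0//= /far_ratio /powR pnatr_eq0 /= expR_lt1.
rewrite pmulr_llt0 ?ln_gt0 ?ltr1n//.
have s0 : 0 < s := lt_trans ltr01 s_gt1.
have s1 : 0 < 1 - s^-1 by rewrite subr_gt0 invf_lt1.
have K0 : 0 < k%:R :> R by rewrite ltr0n.
have := mulr_gt0 K0 s1; lra.
Qed.

Lemma far_ratioE l : (2 ^+ (l * k)) `^ s^-1 = 2 ^+ (l * k) * far_ratio ^+ (2 * l).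
Proof.
rewrite /far_ratio -!powR_mulrn ?ler0n// ?powR_ge0// -!powRrM -powRD; last first.
  by rewrite pnatr_eq0 implybT.
by congr (_ `^ _); rewrite !natrM; field; rewrite lt0r_neq0// (lt_trans ltr01).
Qed.

End far_part.

(** * Weight of the exceptional set of large balls *)

Section far_part_weights.
Context {R : realType} (k : nat) (s : R).
Hypotheses (k_gt0 : (0 < k)%N) (s_gt1 : 1 < s).
Local Notation point := (hpoint R k.+1).
Local Notation H := (halfspace R k.+1).
Local Notation mu := (hvol R k.+1).
Local Notation r := (far_ratio k s).

(** The [6] is the factor [2] of [integral_le_hmaximal_pow] times the [3] of [hvol_level_box_le];
    the base of the power is the volume ratio of ball to box, up to [2 ^+ (l * k)]. *)
Definition far_const : R := 6 * (2 * 16 ^+ k * 4 ^+ ((k + 16) * k)) `^ s^-1.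

Lemma far_const_gt0 : 0 < far_const.
Proof. by rewrite mulr_gt0// powR_gt0// !mulr_gt0// exprn_gt0. Qed.

Variables (w : point -> R).
Hypothesis mw : measurable_fun H w.
Hypothesis w0 : forall p, H p -> 0 <= w p.

Lemma far_source_sub l e bz i : @far_source R k l e bz i `<=` H.
Proof. by apply: box_halfspace; exact: level_gt0. Qed.

Lemma far_target_sub l e bz : @far_target R k l e bz `<=` H.
Proof. by apply: box_halfspace; exact: level_gt0. Qed.

Lemma far_source_weight l e bz i q : far_target l e bz q ->
  (\int[mu]_(p in far_source l e bz i) (w p)%:E <=
   (far_const * 2 ^+ ((odd l + i.*2) * k) * (2 ^+ (l * k) * r ^+ (2 * l)))%:E *
   hmaximal_pow s w q)%E.
Proof.
move=> Vq; have q0 := far_target_sub Vq.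
set d : R := 2 ^+ (i + uphalf l + (k + 16)).
have d0 : 0 < d by rewrite exprn_gt0.
set A0 : R := 2 * 16 ^+ k * 4 ^+ ((k + 16) * k).
have A00 : 0 < A0 by rewrite /A0 !mulr_gt0// exprn_gt0.
set v : R := 3 * 2 ^+ ((odd l + i.*2) * k).
have v0 : 0 < v by rewrite mulr_gt0// exprn_gt0.
have A1 : 0 < A0 * 2 ^+ (l * k) by rewrite mulr_gt0// exprn_gt0.
have dE : d ^+ 2 = 4 ^+ (i + uphalf l + (k + 16)).
  by rewrite /d -exprM mulnC exprM; congr (_ ^+ _); ring.
have := integral_le_hmaximal_pow s_gt1 mw w0 _ q0 d0
  (far_source_sub_dball (i := i) Vq) v0 A1 _ (hvol_dball_gt0 q0 d0) _.
move=> h; apply: (le_trans (h _ _ _)) => {h}.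
- exact: measurable_box.
- rewrite /far_source (far_side bz.1 l i).
  apply: (le_trans (hvol_level_box_le _ _ _)); first by rewrite exprn_ge0.
  by rewrite lee_fin -exprM.
- apply: (le_trans (@hvol_dball_le_large _ _ _ _ (i + uphalf l + (k + 16)) k_gt0 q0 _)).
    by rewrite dE.
  rewrite lee_fin /A0 /v mulnDl exprD.
  rewrite le_eqVlt; apply/orP; left; apply/eqP.
  have -> : 4 ^+ ((i + uphalf l) * k) =
      2 ^+ ((odd l + i.*2) * k) * 2 ^+ (l * k) :> R.
    rewrite -exprD -mulnDl far_exponentD -mulnA [RHS]exprM.
    by congr (_ ^+ _); ring.
  by ring.
rewrite /hmaximal_pow lee_wpmul2r ?poweR_ge0// lee_fin.
rewrite powRM ?exprn_ge0 ?(ltW A00)// far_ratioE// /far_const -/A0 /v.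
by rewrite le_eqVlt; apply/orP; left; apply/eqP; ring.
Qed.

Variables (f : point -> R) (lam c : R).
Hypothesis mf : measurable_fun H f.
Hypotheses (lam_gt0 : 0 < lam) (c_gt0 : 0 < c).

(** The two powers of [2] multiply to the volume of the ball, up to constants; [r ^+ l] is the share
    of the mass that the pigeonhole grants to one height. *)
Definition far_threshold l i : R :=
  lam * c * (2 ^+ (l * k) * r ^+ l) * 2 ^+ ((odd l + i.*2) * k).

Definition far_bad l e bz i := ((far_threshold l i)%:E <=
  \int[mu]_(p in far_target l e bz) `|f p|%:E)%E.

Definition far_union l e bz : set point :=
  \bigcup_i (if far_bad l e bz i then far_source l e bz i else set0).

Lemma measurable_far_union l e bz : measurable (far_union l e bz).
Proof.
by apply: bigcup_measurable => i _; case: ifP => // _; exact: measurable_box.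
Qed.

Lemma far_union_sub l e bz : far_union l e bz `<=` H.
Proof.
apply: bigcup_sub => i _; case: ifP => _; last exact: sub0set.
exact: far_source_sub.
Qed.

(** Each source box weighs at most a constant times its threshold times the infimum of
    [hmaximal_pow] over the target. Admissible thresholds at least double with [i] and stay below
    the mass of [f] on the target, so they sum to at most twice that mass. *)
Lemma far_union_weight l e bz :
  (\int[mu]_(p in far_union l e bz) (w p)%:E <=
   (2 * far_const * r ^+ l / (lam * c))%:E *
   (ereal_inf (hmaximal_pow s w @` far_target l e bz) *
    \int[mu]_(p in far_target l e bz) `|f p|%:E))%E.
Proof.
have [r0 _] := andP (far_ratio_itv k_gt0 s_gt1).
set D := ereal_inf _; set F := (\int[mu]_(p in far_target _ _ _) _)%E.
have D0 : (0 <= D)%E.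
  by apply: le_ereal_inf_tmp => _ [q _ <-]; exact: poweR_ge0.
have F0 : (0 <= F)%E by apply: integral_ge0.
have lc0 : 0 < lam * c by rewrite mulr_gt0.
have b0 i : 0 < far_threshold l i.
  by rewrite /far_threshold !mulr_gt0 ?exprn_gt0.
have bS i : 2 * far_threshold l i <= far_threshold l i.+1.
  have yS : 2 ^+ ((odd l + i.+1.*2) * k) =
      2 ^+ k * 2 ^+ k * 2 ^+ ((odd l + i.*2) * k) :> R.
    by rewrite -!exprD doubleS; congr (_ ^+ _); ring.
  have k2 : 2 <= 2 ^+ k :> R by rewrite -{1}(expr1 2) ler_weXn2l ?ler1n.
  have := b0 i; rewrite /far_threshold yS [leRHS]mulrCA => b1.
  by rewrite ler_pM2r//; nra.
pose K : R := far_const * r ^+ l / (lam * c).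
have K0 : 0 < K by rewrite divr_gt0 ?mulr_gt0 ?far_const_gt0 ?exprn_gt0.
have UD i : (\int[mu]_(p in far_source l e bz i) (w p)%:E <=
    (K * far_threshold l i)%:E * D)%E.
  have Kb : 0 < K * far_threshold l i by rewrite mulr_gt0.
  rewrite -lee_pdivrMl//; apply: le_ereal_inf_tmp => _ [q Vq <-].
  rewrite lee_pdivrMl//; apply: (le_trans (far_source_weight i Vq)).
  rewrite lee_wpmul2r ?poweR_ge0// lee_fin.
  rewrite le_eqVlt; apply/orP; left; apply/eqP.
  rewrite /K /far_threshold.
  have -> : r ^+ (2 * l) = r ^+ l * r ^+ l by rewrite mul2n -addnn exprD.
  by field; rewrite !lt0r_neq0.
apply: ge0_integral_bigcup_le_bound.
- by move=> i; case: ifP => // _; exact: measurable_box.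
- apply/measurable_EFinP; apply: measurable_funS mw; last exact: far_union_sub.
  exact: measurable_halfspace.
- by move=> x /far_union_sub Hx; rewrite lee_fin w0.
move=> N; apply: (@le_trans _ _
    (\sum_(0 <= i < N | far_bad l e bz i) (far_threshold l i)%:E * (K%:E * D))%E).
  rewrite [leRHS]big_mkcond; apply: lee_sum => i _; case: ifP => _.
    by rewrite muleA -EFinM mulrC; exact: UD.
  by rewrite integral_set0.
rewrite -ge0_sume_distrl; last by move=> i _; rewrite lee_fin ltW.
have := sum_doubling_le N b0 bS F0; rewrite -/F => h.
apply: (@le_trans _ _ ((2%:E * F) * (K%:E * D))%E).
  by rewrite lee_wpmul2r// mule_ge0// lee_fin ltW.
rewrite muleACA -EFinM [(F * D)%E]muleC /K.
by rewrite !mulrA.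
Qed.

Lemma far_target_trivIset l e : trivIset setT (@far_target R k l e).
Proof.
apply/trivIsetP => -[b z] [b' z'] _ _; apply: contraNeq => /set0P.
move=> [q [/boxE /= [qx qb] /boxE /= [qx' qb']]]; apply/eqP.
have bb : b = b'.
  move: qb qb' => /andP[q1 q2] /andP[q1' q2'].
  have := le_lt_trans q1 q2'; rewrite level_lt => ?.
  have := le_lt_trans q1' q2; rewrite level_lt => ?.
  lia.
rewrite -{}bb in qx' *; congr pair.
apply: (@grid_cell_inj _ _ (level b * 2 ^+ l) 0 e _ _ (tnth q.1)).
- by rewrite mulr_gt0 ?level_gt0 ?exprn_gt0.
- by move=> i; have := qx i; rewrite expr0 divr1.
- by move=> i; have := qx' i; rewrite expr0 divr1.
Qed.

Definition far_set : set point :=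
  \bigcup_(e in [set: {ffun 'I_k -> bool}]) \bigcup_l \bigcup_bz far_union l e bz.

Lemma far_set_sub : far_set `<=` H.
Proof. by do 3 (apply: bigcup_sub => ? _); exact: far_union_sub. Qed.

Lemma measurable_far_set_slice e l :
  measurable (\bigcup_bz far_union l e bz).
Proof.
apply: countable_bigcupT_measurable => [|bz]; first exact: countableP.
exact: measurable_far_union.
Qed.

Lemma measurable_far_set : measurable far_set.
Proof.
apply: countable_bigcupT_measurable => [|e]; first exact: countableP.
by apply: bigcup_measurable => l _; exact: measurable_far_set_slice.
Qed.

(** Sum over the disjoint targets, then over [l] by the factor [r ^+ l], then over the [2 ^ k]
    grids. *)
Lemma far_set_weight :
  (\int[mu]_(p in far_set) (w p)%:E <=
   (2 ^+ k * (2 * far_const / ((1 - r) * c)))%:E * lam^-1%:E *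
   \int[mu]_(p in H) (`|f p|%:E * hmaximal_pow s w p))%E.
Proof.
have /andP[r0 r1] := far_ratio_itv k_gt0 s_gt1.
set L := (\int[mu]_(p in H) _)%E.
have L0 : (0 <= L)%E by apply: integral_ge0 => p _; rewrite mule_ge0 ?poweR_ge0.
have mwS (A : set point) : A `<=` H -> measurable_fun A (EFin \o w).
  move=> AH; apply/measurable_EFinP; apply: measurable_funS mw => //.
  exact: measurable_halfspace.
have w0S (A : set point) : A `<=` H -> forall x, A x -> (0 <= (w x)%:E)%E.
  by move=> AH x /AH Hx; rewrite lee_fin w0.
have slice e l : \bigcup_bz far_union l e bz `<=` H.
  by apply: bigcup_sub => bz _; exact: far_union_sub.
have slices e : \bigcup_l \bigcup_bz far_union l e bz `<=` H.
  by apply: bigcup_sub => l _; exact: slice.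
pose M : R := 2 * far_const / (lam * c).
have M0 : 0 < M by rewrite divr_gt0 ?mulr_gt0 ?far_const_gt0.
apply: (@le_trans _ _ (#|{ffun 'I_k -> bool}|%:R%:E *
    (((1 - r)^-1)%:E * (M%:E * L)))%E); last first.
  rewrite card_ffun card_bool card_ord natrX !muleA -!EFinM.
  rewrite lee_wpmul2r// lee_fin le_eqVlt; apply/orP; left; apply/eqP.
  rewrite /M; field; rewrite !lt0r_neq0//.
  by rewrite subr_gt0.
apply: integral_bigcup_finite.
- by move=> e; apply: bigcup_measurable => l _; exact: measurable_far_set_slice.
- by apply: mwS; exact: far_set_sub.
- by apply: w0S; exact: far_set_sub.
- by rewrite !mule_ge0// lee_fin ?invr_ge0 ?subr_ge0 ltW.
move=> e; apply: integral_bigcup_geometric.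
- by rewrite r0.
- by rewrite mule_ge0// lee_fin ltW.
- by move=> l; exact: measurable_far_set_slice.
- by apply: mwS; exact: slices.
- by apply: w0S; exact: slices.
move=> l; rewrite muleA -EFinM.
apply: (integral_bigcup_le_weighted (V := far_target l e)
  (D := fun bz => ereal_inf (hmaximal_pow s w @` far_target l e bz))) => //.
- by rewrite mulr_ge0 ?exprn_ge0 ?ltW.
- exact: measurable_halfspace.
- by move=> bz; exact: measurable_far_union.
- by move=> bz; exact: far_union_sub.
- by move=> bz; exact: measurable_box.
- by move=> bz; exact: far_target_sub.
- exact: far_target_trivIset.
- exact: mwS.
- apply/measurable_EFinP; apply: measurableT_comp mf => //.
- by move=> x _; exact: poweR_ge0.
- by move=> bz; apply: le_ereal_inf_tmp => _ [q _ <-]; exact: poweR_ge0.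
- by move=> bz q Vq; apply: ereal_inf_lbound; exists q.
move=> bz; rewrite (_ : _ * M = 2 * far_const * r ^+ l / (lam * c)).
  exact: far_union_weight.
by rewrite /M; ring.
Qed.

End far_part_weights.

(** * Pigeonhole over the heights of a large ball *)

Section far_cover.
Context {R : realType} (k : nat) (s : R).
Hypotheses (k_gt0 : (0 < k)%N) (s_gt1 : 1 < s).
Local Notation point := (hpoint R k.+1).
Local Notation H := (halfspace R k.+1).
Local Notation mu := (hvol R k.+1).

(** Slab [m] from the top, at level [a + rho.+1 - m], is given [l = m + 4]. The first identity puts
    source [i] back at level [a]; the second computes its side in units of [level a]. *)
Let far_index (rho m : nat) : (m < 2 * rho + 3)%N ->
  ((m + 4)./2 + rho.+1 = (2 * rho + 6 - m)./2 + m)%N /\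
  (odd (m + 4) + ((2 * rho + 6 - m)./2).*2 = 2 * rho + 2 - m + 4)%N.
Proof.
clear => mr; have := odd_double_half (m + 4).
move: (odd (m + 4)) ((m + 4)./2) => b h mE.
have -> : (2 * rho + 6 - m = b + (rho + 5 - h - b).*2)%N.
  by case: b mE => /= mE; lia.
by rewrite half_bit_double; case: b mE => /= mE; lia.
Qed.

(** If no target around [p] were bad, the thresholds would sum to at most [lam] times a lower bound
    for the volume of the ball, contradicting the large average. *)
Lemma far_set_cover (d0 : R) : 0 < d0 <= 1 ->
  exists2 c : R, 0 < c & forall (f : point -> R) (lam : R),
    measurable_fun H f -> 0 < lam -> forall (p : point) (d : R),
    H p -> d0 <= d ->
    (lam%:E * mu (dball p d) < \int[mu]_(q in dball p d) `|f q|%:E)%E ->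
    far_set s f lam c p.
Proof.
move=> d01; have [c1 c10 c1P] := hvol_dball_ge_far k d01.
have /andP[r0 r1] := far_ratio_itv k_gt0 s_gt1; set r := far_ratio k s in r0 r1.
have r10 : 0 < 1 - r by rewrite subr_gt0.
(* The factor [1 - r] pays for the geometric series; [4 ^+ (5 * k)] arises because the two exponents
   of [2] in the threshold add up to [2 * rho + 10] times [k]. *)
exists (c1 * (1 - r) / 4 ^+ (5 * k)) => [|f lam mf lam0 p d p0 dd pf].
  by rewrite divr_gt0 ?mulr_gt0// exprn_gt0.
have [rho dr rd] := far_scale d.
have [a ap] := level_ex (p0 : 0 < p.2).
have la0 := level_gt0 a (R := R).
pose b (m : nat) : int := a + rho.+1%:Z - m%:Z.
pose i (m : nat) : nat := (2 * rho + 6 - m)./2.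
have bi m : (m < 2 * rho + 3)%N -> b m + (m + 4)./2%:Z - (i m)%:Z = a.
  move=> mr; have [/(congr1 Posz) + _] := far_index mr.
  rewrite /b /i !PoszD; move: ((m + 4)./2) ((_ - m)./2) => x y; clear; lia.
have ki m : (m < 2 * rho + 3)%N ->
    (odd (m + 4) + (i m).*2 = (2 * rho + 2 - m) + 4)%N.
  by move=> mr; have [_ ->] := far_index mr.
have L0 m : 0 < level (b m) * 2 ^+ (m + 4) :> R.
  by rewrite mulr_gt0 ?level_gt0// exprn_gt0.
have /choice[ez ezP] : forall m : nat, exists ez : {ffun 'I_k -> bool} *
    {ffun 'I_k -> int}, forall y : 'I_k -> R,
    (forall j, `|y j - tnth p.1 j| * 6 < level (b m) * 2 ^+ (m + 4)) ->
    forall j, far_corner (m + 4) ez.1 (b m, ez.2) j <= y j <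
      far_corner (m + 4) ez.1 (b m, ez.2) j + level (b m) * 2 ^+ (m + 4).
  move=> m; have [e [z ezP]] := grid_cell_ex 0 (tnth p.1) (L0 m).
  exists (e, z) => y yp j; have := ezP y; rewrite expr0 divr1; apply.
  by move=> j'; rewrite mulr1.
pose V (m : nat) : set point := if (m < 2 * rho + 3)%N
  then far_target (m + 4) (ez m).1 (b m, (ez m).2) else set0.
have [[m [mr mbad]]|nbad] := pselect (exists m, (m < 2 * rho + 3)%N /\
    far_bad s f lam (c1 * (1 - r) / 4 ^+ (5 * k)) (m + 4) (ez m).1
      (b m, (ez m).2) (i m)).
  exists (ez m).1 => //; exists (m + 4)%N => //; exists (b m, (ez m).2) => //.
  exists (i m) => //; rewrite mbad; apply/boxE; split.
    by apply: ezP => j; rewrite subrr normr0 mul0r.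
  by rewrite /= bi.
have dV : dball p d `<=` \bigcup_m V m.
  move=> q pq; have [j jr [qb qp]] := dball_level_cover p0 ap dr pq.
  have mr : (2 * rho + 2 - j < 2 * rho + 3)%N by clear - jr; lia.
  exists (2 * rho + 2 - j)%N => //; rewrite /V mr; apply/boxE; split.
    (* The slab spreads less than [level a * 2 ^+ j.+1] from [p], an eighth of the cell side, while
       the one-third trick allows a sixth. *)
    apply: ezP => j'; have := qp j'; rewrite distrC => h.
    rewrite (far_side _ _ (i (2 * rho + 2 - j)%N)) bi// ki//.
    rewrite (_ : (_ - (_ - j) + 4)%N = j.+1 + 3)%N; last by clear - jr; lia.
    rewrite exprD; have : 0 < level a * 2 ^+ j.+1 :> R by rewrite mulr_gt0 ?exprn_gt0.
    by rewrite mulrA (_ : 2 ^+ 3 = 8 :> R); [lra | ring].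
  rewrite /= (_ : b _ = a + j%:Z - rho.+1%:Z)//.
  by rewrite /b; clear - jr; lia.
have VH : \bigcup_m V m `<=` H.
  apply: bigcup_sub => m _; rewrite /V; case: ifP => _; last exact: sub0set.
  exact: far_target_sub.
have : (\int[mu]_(q in dball p d) `|f q|%:E <= (lam * (c1 * 4 ^+ (rho * k)))%:E)%E.
  apply: (@le_trans _ _ (\int[mu]_(q in \bigcup_m V m) `|f q|%:E)%E).
    exact: ge0_le_integral_subset.
  apply: le_trans
    (integral_bigcup_geometric (r := r)
      (c := (lam * (c1 * (1 - r) * 4 ^+ (rho * k)))%:E) _ _ _ _ _ _) _ => //.
  - by rewrite r0.
  - by rewrite lee_fin !mulr_ge0 ?exprn_ge0 ?ltW.
  - by move=> m; rewrite /V; case: ifP => // _; exact: measurable_box.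
  - apply: measurable_funS VH _; first exact: measurable_halfspace.
    by apply/measurable_EFinP; exact: measurableT_comp mf.
  - move=> m; rewrite /V; case: ifPn => mr; last first.
      rewrite integral_set0 -EFinM lee_fin.
      by rewrite !mulr_ge0 ?exprn_ge0 ?ltW.
    have /negP : ~ far_bad s f lam (c1 * (1 - r) / 4 ^+ (5 * k)) (m + 4) (ez m).1
      (b m, (ez m).2) (i m) by move=> h; apply: nbad; exists m.
    rewrite /far_bad -ltNge => /ltW/le_trans; apply.
    rewrite -EFinM lee_fin /far_threshold ki// -/r.
    have -> : (2 : R) ^+ ((2 * rho + 2 - m + 4) * k) =
        4 ^+ (rho * k) * 4 ^+ (5 * k) / 2 ^+ ((m + 4) * k).
      rewrite -exprD -mulnDl (_ : 4 = 2 ^+ 2 :> R); last by ring.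
      rewrite -exprM; apply: (mulIf (_ : 2 ^+ ((m + 4) * k) != 0)).
        by rewrite expf_neq0.
      rewrite divfK ?expf_neq0// -exprD; congr (_ ^+ _).
      by rewrite -mulnDl mulnA; congr (_ * _)%N; clear - mr; lia.
    rewrite [leLHS](_ : _ = r ^+ 4 * (r ^+ m * (lam * (c1 * (1 - r) * 4 ^+ (rho * k))))).
      rewrite ler_piMl ?exprn_ile1 ?ltW//.
      by rewrite !mulr_gt0 ?exprn_gt0.
    rewrite exprD; field; rewrite !expf_neq0//.
  rewrite -EFinM lee_fin le_eqVlt; apply/orP; left; apply/eqP.
  by field; rewrite lt0r_neq0.
move=> le; exfalso; move: le; apply/negP; rewrite -ltNge; apply: le_lt_trans pf.
by rewrite EFinM lee_pmul2l ?lte_fin//; exact: c1P.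
Qed.

End far_cover.

(** * Small balls *)

Section maximal_cells.
Context {T K : Type} (Q : nat -> K -> set T) (bad : nat -> K -> Prop).

Definition maximal_cell m z := bad m z /\
  forall m' z', (m' < m)%N -> bad m' z' -> ~ Q m z `<=` Q m' z'.

(** Take the least index of a bad cell through [x]: a coarser bad cell around the chosen one would
    also contain [x]. *)
Lemma maximal_cell_ex m z x : bad m z -> Q m z x ->
  exists m' z', maximal_cell m' z' /\ Q m' z' x.
Proof.
move=> bmz Qx; pose P m := `[< exists z, bad m z /\ Q m z x >].
have exP : exists m, P m by exists m; apply/asboolP; exists z.
case: (ex_minnP exP) => m' /asboolP[z' [b' Q']] min'.
exists m', z'; split=> //; split=> // m'' z'' m''m' b'' sub.
have : P m'' by apply/asboolP; exists z''; split=> //; exact: sub.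
by move/min'; rewrite leqNgt m''m'.
Qed.

Hypothesis nested : forall m m' z z' x, (m' <= m)%N -> Q m z x -> Q m' z' x ->
  Q m z `<=` Q m' z'.
Hypothesis Q_inj : forall m z z' x, Q m z x -> Q m z' x -> z = z'.

Lemma maximal_cell_inj m m' z z' x : maximal_cell m z -> maximal_cell m' z' ->
  Q m z x -> Q m' z' x -> (m, z) = (m', z').
Proof.
wlog mm' : m m' z z' / (m' <= m)%N => [hw|].
  have [/hw h|/ltnW/hw h] := leqP m' m; first exact: h.
  by move=> ? ? ? ?; apply/esym/h.
move=> [bz maxz] [bz' _] Qx Qx'.
move: mm'; rewrite leq_eqVlt => /predU1P[mm'|m'm].
  by rewrite mm' in Qx' *; rewrite (Q_inj Qx Qx').
by case: (maxz _ _ m'm bz'); exact: nested (ltnW m'm) Qx Qx'.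
Qed.

End maximal_cells.

(** * Nested cubes at bounded height and their weight *)

Section local_part.
Context {R : realType} (k : nat) (s : R).
Hypotheses (s_gt1 : 1 < s).
Local Notation point := (hpoint R k.+1).
Local Notation H := (halfspace R k.+1).
Local Notation mu := (hvol R k.+1).
Local Notation n := (k.+1%:R : R).

(** The index at the coarser level [m'] is the integer quotient by [2 ^+ (m - m')] of the index at
    level [m], so it is shared by the whole finer cell. *)
Lemma grid_corner_nested (h : R) (m m' : nat) (e : bool) (z z' : int) (x y : R) :
  0 < h -> (m' <= m)%N ->
  grid_corner h m e z <= x < grid_corner h m e z + h / 2 ^+ m ->
  grid_corner h m e z <= y < grid_corner h m e z + h / 2 ^+ m ->
  grid_corner h m' e z' <= x < grid_corner h m' e z' + h / 2 ^+ m' ->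
  grid_corner h m' e z' <= y < grid_corner h m' e z' + h / 2 ^+ m'.
Proof.
move=> h0 mm; rewrite !grid_cornerP//; set X := x / h + _; set Y := y / h + _.
have stepE (Z : R) : (Num.floor (2 ^+ m' * Z) == z') =
    (z' * 2 ^+ (m - m') <= Num.floor (2 ^+ m * Z) < (z' + 1) * 2 ^+ (m - m')).
  have p0 : 0 < 2 ^+ (m - m') :> R by rewrite exprn_gt0.
  rewrite real_floor_ge_int ?num_real// real_floor_lt_int ?num_real//.
  rewrite real_floor_eq ?num_real// !rmorphM rmorphXn /=.
  by rewrite -{2 3}(subnK mm) exprD -mulrA ![_ * 2 ^+ (m - m')]mulrC ler_pM2l// ltr_pM2l.
by rewrite !stepE => /eqP -> /eqP ->.
Qed.

Definition local_cell (a : int) (et : {ffun 'I_k -> bool} * bool) (m : nat)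
    (z : {ffun 'I_k -> int} * int) : set point :=
  box (grid_cell (level a) m et.1 z.1) (level a / 2 ^+ m)
    (grid_corner (level a) m et.2 z.2)
    (grid_corner (level a) m et.2 z.2 + level a / 2 ^+ m).

Lemma local_cell_nested a et m m' z z' x : (m' <= m)%N ->
  local_cell a et m z x -> local_cell a et m' z' x ->
  local_cell a et m z `<=` local_cell a et m' z'.
Proof.
move=> mm /boxE[xi xt] /boxE[xi' xt'] y /boxE[yi yt]; apply/boxE.
have l0 := level_gt0 a (R := R).
split; last exact: grid_corner_nested xt yt xt'.
by move=> i; exact: grid_corner_nested (xi i) (yi i) (xi' i).
Qed.

Lemma local_cell_inj a et m z z' x :
  local_cell a et m z x -> local_cell a et m z' x -> z = z'.
Proof.
case: z z' => [z j] [z' j'] /boxE[/= xi xt] /boxE[/= xi' xt'].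
have l0 := level_gt0 a (R := R).
congr pair; first exact: grid_cell_inj xi xi'.
by move: xt xt'; rewrite !grid_cornerP// => /eqP <- /eqP <-.
Qed.

(** Satisfied by cells of side at most [level a / 2] through a point of height in [[4^a, 4^(a+1))].
    The two bounds differ by a factor [10 < 16], so levels two apart give disjoint slabs. *)
Definition local_height (a : int) (et : {ffun 'I_k -> bool} * bool) (m : nat)
    (z : {ffun 'I_k -> int} * int) : bool :=
  (level a / 2 <= grid_corner (level a : R) m et.2 z.2) &&
  (grid_corner (level a : R) m et.2 z.2 + level a / 2 ^+ m <= 5 * level a).

Lemma local_cell_sub a et m z : local_height a et m z ->
  local_cell a et m z `<=` H.
Proof.
move=> /andP[h1 _]; apply: box_halfspace; apply: lt_le_trans h1.
by rewrite divr_gt0// level_gt0.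
Qed.

Variables (w : point -> R).
Hypothesis mw : measurable_fun H w.
Hypothesis w0 : forall p, H p -> 0 <= w p.

(** The base is the bound of [hvol_dball_le_small] for [K = 16 n^2] and [d = 4 n / 2^m], divided by
    the cell bound [(2 / 2^m)^n]. *)
Definition local_const : R := 2 * (((16 * n ^+ 2 + 2) ^+ 2 * (4 * n)) ^+ k.+1) `^ s^-1.

Lemma local_const_gt0 : 0 < local_const.
Proof.
have n0 : 0 < n by rewrite ltr0n.
by rewrite mulr_gt0// powR_gt0// exprn_gt0// !mulr_gt0// exprn_gt0// addr_gt0// mulr_gt0// exprn_gt0.
Qed.

Lemma local_cell_weight a et m z q : local_height a et m z ->
  local_cell a et m z q ->
  (\int[mu]_(p in local_cell a et m z) (w p)%:E <=
   (local_const * (2 / 2 ^+ m) ^+ k.+1)%:E * hmaximal_pow s w q)%E.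
Proof.
move=> hz Qq; have q0 := local_cell_sub hz Qq.
have n0 : 0 < n by rewrite ltr0n.
have n1 : 1 <= n by rewrite ler1n.
have l0 := level_gt0 a (R := R).
have P0 : 0 < 2 ^+ m :> R by rewrite exprn_gt0.
have P1 : 1 <= 2 ^+ m :> R by rewrite exprn_ege1// ler1n.
(* In a cell of side [L] squared distances are at most [n * L ^+ 2], and heights are at least
   [level a / 2]; this [d] gives [(level a / 2) ^+ 2 * d ^+ 2 = 4 * n ^+ 2 * L ^+ 2]. *)
set d : R := 4 * n / 2 ^+ m.
have d0 : 0 < d by rewrite !mulr_gt0// invr_gt0.
have dn : d <= 4 * n by rewrite ler_pdivrMr// ler_peMr// mulr_ge0// ltW.
have dK : d ^+ 2 <= 16 * n ^+ 2.
  rewrite (_ : 16 * n ^+ 2 = (4 * n) ^+ 2); last by ring.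
  by rewrite lerXn2r ?nnegrE ?(ltW d0)// mulr_ge0// ltW.
set v : R := (2 / 2 ^+ m) ^+ k.+1.
have v0 : 0 < v by rewrite exprn_gt0// divr_gt0.
set A : R := ((16 * n ^+ 2 + 2) ^+ 2 * (4 * n)) ^+ k.+1.
have K0 : 0 <= 16 * n ^+ 2 by rewrite mulr_ge0// exprn_ge0// ltW.
have A0 : 0 < A.
  by rewrite exprn_gt0// !mulr_gt0// exprn_gt0// ltr_wpDl.
have /andP[hl _] := hz.
have al0 := lt_le_trans (divr_gt0 l0 (ltr0Sn _ 1)) hl.
set L : R := level a / 2 ^+ m; have L0 : 0 < L by rewrite divr_gt0.
have sub : local_cell a et m z `<=` dball q d.
  move=> p Qp; split; first exact: local_cell_sub Qp.
  have /boxE[/= qx /andP[q1 q2]] := Qq; have /boxE[/= px /andP[p1 p2]] := Qp.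
  have xi j : (tnth q.1 j - tnth p.1 j) ^+ 2 <= L ^+ 2.
    have := qx j; have := px j; rewrite -/L => /andP[x1 x2] /andP[x3 x4].
    by clear - L0 x1 x2 x3 x4; clearbody L; nra.
  have ti : (q.2 - p.2) ^+ 2 <= L ^+ 2.
    move: q1 q2 p1 p2; rewrite -/L => q1 q2 p1 p2.
    by clear - L0 q1 q2 p1 p2; clearbody L; nra.
  apply: (le_lt_trans (sqdist_le xi ti)).
  have -> : k.+1.-1%:R * L ^+ 2 + L ^+ 2 = n * L ^+ 2.
    by rewrite -[n]natr1 mulrDl mul1r.
  have qa := le_trans hl q1; have pa := le_trans hl p1.
  have tu : level a / 2 * (level a / 2) <= q.2 * p.2.
    by rewrite ler_pM// divr_ge0// ltW.
  apply: (@lt_le_trans _ _ (level a / 2 * (level a / 2) * d ^+ 2)); last first.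
    by rewrite ler_pM2r// exprn_gt0.
  rewrite (_ : _ * d ^+ 2 = n * (4 * n) * L ^+ 2); last first.
    by rewrite /d /L; field; rewrite lt0r_neq0.
  by rewrite ltr_pM2r ?exprn_gt0// ltr_pMr//; lra.
have := integral_le_hmaximal_pow s_gt1 mw w0 _ q0 d0 sub v0 A0 _
  (hvol_dball_gt0 q0 d0) _.
move=> h; apply: (le_trans (h _ _ _)) => {h}.
- exact: measurable_box.
- apply: (le_trans (hvol_box_le _ (ltW L0) al0 _)); first by rewrite lerDl ltW.
  rewrite lee_fin addrAC subrr add0r -exprSr -exprVn -exprMn /v.
  rewrite lerXn2r// ?nnegrE ?divr_ge0 ?(ltW l0) ?(ltW al0) ?(ltW P0)//.
  rewrite ler_pdivrMr//; apply: (@le_trans _ _ (2 / 2 ^+ m * (level a / 2))).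
    by rewrite le_eqVlt /L; apply/orP; left; apply/eqP; field; rewrite lt0r_neq0.
  by rewrite ler_pM2l// divr_gt0.
- apply: (le_trans (hvol_dball_le_small q0 d0 K0 dK)).
  rewrite lee_fin /A /v -exprMn /d le_eqVlt; apply/orP; left; apply/eqP.
  by congr (_ ^+ _); field; rewrite lt0r_neq0.
rewrite /hmaximal_pow lee_wpmul2r ?poweR_ge0// lee_fin /local_const -/A.
by rewrite le_eqVlt; apply/orP; left; apply/eqP; ring.
Qed.

End local_part.

(** * Maximal bad cubes and the covering by small balls *)

Section local_cover.
Context {R : realType} (k : nat) (s : R).
Hypotheses (s_gt1 : 1 < s).
Local Notation point := (hpoint R k.+1).
Local Notation H := (halfspace R k.+1).
Local Notation mu := (hvol R k.+1).
Local Notation n := (k.+1%:R : R).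
Local Notation cell := (@local_cell R k).
Variables (f : point -> R) (lam c : R).

Definition local_bad a et m z : Prop := @local_height R k a et m z /\
  ((lam * c * (2 / 2 ^+ m) ^+ k.+1)%:E <=
   \int[mu]_(p in cell a et m z) `|f p|%:E)%E.

(* Levels of equal parity, so that the slabs containing their cells are
   disjoint. *)
Definition local_level (par : bool) (a : int) : int := a * 2 + par%:Z.

(** Non-maximal indices carry the empty set, so that for fixed parity and shifts the pieces are
    disjoint over all heights and sizes. *)
Definition local_piece (pe : bool * ({ffun 'I_k -> bool} * bool))
    (i : int * (nat * ({ffun 'I_k -> int} * int))) : set point :=
  let a := local_level pe.1 i.1 in
  if `[< maximal_cell (cell a pe.2) (local_bad a pe.2) i.2.1 i.2.2 >]
  then cell a pe.2 i.2.1 i.2.2 else set0.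

Definition local_set : set point := \bigcup_pe \bigcup_i local_piece pe i.

Lemma measurable_local_piece pe i : measurable (local_piece pe i).
Proof. by rewrite /local_piece; case: ifP => // _; exact: measurable_box. Qed.

Lemma measurable_local_slice pe : measurable (\bigcup_i local_piece pe i).
Proof.
apply: countable_bigcupT_measurable => [|i]; first exact: countableP.
exact: measurable_local_piece.
Qed.

Lemma measurable_local_set : measurable local_set.
Proof.
apply: countable_bigcupT_measurable => [|pe]; first exact: countableP.
exact: measurable_local_slice.
Qed.

Lemma local_piece_sub pe i : local_piece pe i `<=` H.
Proof.
rewrite /local_piece; case: ifPn => [/asboolP[[hz _] _]|_]; last exact: sub0set.
exact: local_cell_sub.
Qed.

Lemma local_slice_sub pe : \bigcup_i local_piece pe i `<=` H.
Proof. by apply: bigcup_sub => i _; exact: local_piece_sub. Qed.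

Lemma local_set_sub : local_set `<=` H.
Proof. by apply: bigcup_sub => pe _; exact: local_slice_sub. Qed.

Lemma local_piece_trivIset pe : trivIset setT (local_piece pe).
Proof.
apply/trivIsetP => -[a [m z]] [a' [m' z']] _ _; apply: contraNeq => /set0P.
move=> [q []]; rewrite /local_piece /=.
case: ifPn => // /asboolP mz Qq; case: ifPn => // /asboolP mz' Qq'; apply/eqP.
have aa' : a = a'.
  have [[/andP[h1 h2] _] _] := mz; have [[/andP[h1' h2'] _] _] := mz'.
  have /boxE[_ /andP[q1 q2]] := Qq; have /boxE[_ /andP[q1' q2']] := Qq'.
  have lt8 (b b' : int) : b < b' ->
      8 * level (local_level pe.1 b) <= level (local_level pe.1 b') / 2 :> R.
    move=> bb'; rewrite ler_pdivlMr// mulrAC -natrM.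
    have -> : (8 * 2)%:R * level (local_level pe.1 b) =
        level (local_level pe.1 b + 2%:Z) :> R.
      by rewrite levelDn mulrC; congr (_ * _); rewrite -natrX.
    rewrite leNgt level_lt -leNgt /local_level.
    by clear - bb'; lia.
  have l0 := level_gt0 (local_level pe.1 a) (R := R).
  have l0' := level_gt0 (local_level pe.1 a') (R := R).
  have [/lt8 h|/lt8 h|//] := ltgtP a a'; exfalso; lra.
rewrite -aa' in mz' Qq' *; congr pair.
by apply: (maximal_cell_inj _ _ mz mz' Qq Qq');
  [exact: local_cell_nested | exact: local_cell_inj].
Qed.

Hypothesis mf : measurable_fun H f.
Hypotheses (lam_gt0 : 0 < lam) (c_gt0 : 0 < c).
Variables (w : point -> R).
Hypothesis mw : measurable_fun H w.
Hypothesis w0 : forall p, H p -> 0 <= w p.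

(** Badness bounds the volume of the cube by the mass of [f] over [lam], and [local_cell_weight]
    bounds its weight by that volume times each value of [hmaximal_pow] on it. *)
Lemma local_piece_weight pe i :
  (\int[mu]_(p in local_piece pe i) (w p)%:E <=
   (local_const k s / (lam * c))%:E *
   (ereal_inf (hmaximal_pow s w @` local_piece pe i) *
    \int[mu]_(p in local_piece pe i) `|f p|%:E))%E.
Proof.
case: i => a [m z]; rewrite /local_piece /=; case: ifPn => [/asboolP[[hz Fz] _]|_];
  last first.
  have i0 g : (\int[mu]_(p in set0) g p = 0)%E := integral_set0 mu g.
  by rewrite (i0 (fun p => (w p)%:E)) (i0 (fun p => `|f p|%:E)) !mule0.
move: hz Fz; set b := local_level _ _ => hz Fz.
set D := ereal_inf _; set F := (\int[mu]_(p in cell b _ _ _) `|f p|%:E)%E in Fz *.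
have D0 : (0 <= D)%E.
  by apply: le_ereal_inf_tmp => _ [q _ <-]; exact: poweR_ge0.
have lc0 : 0 < lam * c by rewrite mulr_gt0.
set v : R := (2 / 2 ^+ m) ^+ k.+1 in Fz.
have v0 : 0 < v by rewrite exprn_gt0// divr_gt0// exprn_gt0.
have C0 := local_const_gt0 k s.
have Cv : 0 < local_const k s * v by rewrite mulr_gt0.
have UD : (\int[mu]_(p in cell b pe.2 m z) (w p)%:E <=
    (local_const k s * v)%:E * D)%E.
  rewrite -lee_pdivrMl//; apply: le_ereal_inf_tmp => _ [q Vq <-].
  by rewrite lee_pdivrMl//; exact: (local_cell_weight s_gt1 mw w0 hz Vq).
apply: (le_trans UD).
have -> : local_const k s * v = local_const k s / (lam * c) * (lam * c * v).
  by field; rewrite !lt0r_neq0.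
have K0 : 0 <= local_const k s / (lam * c) by rewrite divr_ge0 ?(ltW C0) ?(ltW lc0).
rewrite EFinM -muleA lee_wpmul2l ?lee_fin// muleC.
by rewrite lee_wpmul2l.
Qed.

Lemma local_set_weight :
  (\int[mu]_(p in local_set) (w p)%:E <=
   (2 ^+ k.+2 * (local_const k s / c))%:E * lam^-1%:E *
   \int[mu]_(p in H) (`|f p|%:E * hmaximal_pow s w p))%E.
Proof.
set L := (\int[mu]_(p in H) _)%E.
have L0 : (0 <= L)%E by apply: integral_ge0 => p _; rewrite mule_ge0 ?poweR_ge0.
have mwS (A : set point) : A `<=` H -> measurable_fun A (EFin \o w).
  move=> AH; apply/measurable_EFinP; apply: measurable_funS mw => //.
  exact: measurable_halfspace.
have w0S (A : set point) : A `<=` H -> forall x, A x -> (0 <= (w x)%:E)%E.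
  by move=> AH x /AH Hx; rewrite lee_fin w0.
have C0 := local_const_gt0 k s.
pose M : R := local_const k s / (lam * c).
have M0 : 0 < M by rewrite divr_gt0 ?mulr_gt0.
apply: (@le_trans _ _ (#|{: bool * ({ffun 'I_k -> bool} * bool)}|%:R%:E *
    (M%:E * L))%E); last first.
  rewrite !card_prod card_ffun card_bool card_ord !natrM natrX !muleA -!EFinM.
  rewrite lee_wpmul2r// lee_fin le_eqVlt; apply/orP; left; apply/eqP.
  by rewrite /M !exprS; field; rewrite !lt0r_neq0.
apply: integral_bigcup_finite.
- exact: measurable_local_slice.
- by apply: mwS; exact: local_set_sub.
- by apply: w0S; exact: local_set_sub.
- by rewrite mule_ge0// lee_fin ltW.
move=> pe; apply: (integral_bigcup_le_weighted (V := local_piece pe)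
  (D := fun i => ereal_inf (hmaximal_pow s w @` local_piece pe i))) => //.
- by rewrite ltW.
- exact: measurable_halfspace.
- by move=> i; exact: measurable_local_piece.
- by move=> i; exact: local_piece_sub.
- by move=> i; exact: measurable_local_piece.
- by move=> i; exact: local_piece_sub.
- exact: local_piece_trivIset.
- exact: mwS.
- apply/measurable_EFinP; apply: measurableT_comp mf => //.
- by move=> x _; exact: poweR_ge0.
- by move=> i; apply: le_ereal_inf_tmp => _ [q _ <-]; exact: poweR_ge0.
- by move=> i q Vq; apply: ereal_inf_lbound; exists q.
by move=> i; exact: local_piece_weight.
Qed.

Lemma local_scale (x : R) : 0 < x <= 1 / 2 ->
  exists2 m, (0 < m)%N & 2 ^+ m * x <= 1 < 2 ^+ m.+1 * x.
Proof.
move=> /andP[x0 x1].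
have ex : exists m, 1 < 2 ^+ m * x.
  exists (Num.bound x^-1); rewrite -ltr_pdivrMr// div1r.
  have := archi_boundP (ltW (_ : 0 < x^-1)); rewrite invr_gt0 => /(_ x0) h.
  apply: (lt_trans h); rewrite -natrX ltr_nat ltn_expl//.
case: (ex_minnP ex) => -[|m] mx min; first by rewrite expr0 in mx; lra.
exists m; last by rewrite mx andbT leNgt; apply/negP => /min; rewrite ltnn.
case: m {min} mx => // ; rewrite expr1; lra.
Qed.

Lemma local_set_cover p d : c = (768 * n) ^- k.+1 -> H p -> 0 < d <= 96^-1 ->
  (lam%:E * mu (dball p d) < \int[mu]_(q in dball p d) `|f q|%:E)%E ->
  local_set p.
Proof.
move=> cE p0 /andP[d0 d96] pf; have t0 : 0 < p.2 by [].
have n0 : 0 < n by rewrite ltr0n.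
(* Coordinates vary by less than [8 * level a * d] in the ball and the one-third trick costs
   [6 * 2 ^+ m], whence [48]; [d <= 96^-1] makes [m] positive, so the side is at most
   [level a / 2]. *)
have [m m0 /andP[m1 m2]] : exists2 m, (0 < m)%N &
    2 ^+ m * (48 * d) <= 1 < 2 ^+ m.+1 * (48 * d).
  by apply: local_scale; apply/andP; split; lra.
have [a /andP[ap pa]] := level_ex t0; have la0 := level_gt0 a (R := R).
have P0 : 0 < 2 ^+ m :> R by rewrite exprn_gt0.
rewrite levelS in pa.
have [ex [zx xP]] := grid_cell_ex m (tnth p.1) la0.
have [[et zt] /= tP] := grid_corner_ex m p.2 la0.
have close (x : R) : x ^+ 2 < 3 * p.2 ^+ 2 * d ^+ 2 -> `|x| * (6 * 2 ^+ m) < level a.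
  move=> x2; have x8 : `|x| < 8 * level a * d.
    rewrite -(@ltr_pXn2r _ 2)// ?nnegrE ?mulr_ge0 ?(ltW la0) ?(ltW d0)//.
    rewrite real_normK ?num_real// (lt_trans x2)//.
    have -> : (8 * level a * d) ^+ 2 = (64 * level a ^+ 2) * d ^+ 2 by ring.
    by rewrite ltr_pM2r ?exprn_gt0//; nra.
  apply: (@lt_le_trans _ _ (8 * level a * d * (6 * 2 ^+ m))).
    by rewrite ltr_pM2r// mulr_gt0.
  rewrite (_ : _ * _ = level a * (2 ^+ m * (48 * d))); last by ring.
  by rewrite ler_piMr// ltW.
have z3 : (0 : R) ^+ 2 < 3 * p.2 ^+ 2 * d ^+ 2.
  by rewrite expr0n/= !mulr_gt0// exprn_gt0.
have pQ : cell a (ex, et) m (zx, zt) p.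
  apply/boxE; split=> /=; last by apply: tP; rewrite subrr; exact: close.
  by apply: xP => i; rewrite subrr; exact: close.
have sub : dball p d `<=` cell a (ex, et) m (zx, zt).
  move=> q pq; have d1 : d ^+ 2 <= 1.
    by rewrite expr2; nra.
  have qt := dball_height_le ler01 p0 d1 pq.
  have S : sqdist p q < 3 * p.2 ^+ 2 * d ^+ 2.
    apply: (lt_le_trans pq.2); rewrite ler_pM2r ?exprn_gt0// expr2.
    by nra.
  apply/boxE; split=> /=.
    apply: xP => i; apply: close; rewrite -sqrrN opprB.
    exact: le_lt_trans (sqdist_coord_le p q i) S.
  apply: tP; apply: close; rewrite -sqrrN opprB.
  exact: le_lt_trans (sqdist_height_le p q) S.
have hz : @local_height R k a (ex, et) m (zx, zt).
  have /boxE[_ /andP[/= p1 p2]] := pQ.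
  have Lh : level a / 2 ^+ m <= level a / 2 :> R.
    rewrite ler_pM2l// lef_pV2 ?posrE//.
    by rewrite -{1}(expr1 2) ler_weXn2l// ler1n.
  by apply/andP; split => /=; lra.
have bad : local_bad a (ex, et) m (zx, zt).
  split=> //; apply: (@le_trans _ _ (\int[mu]_(q in dball p d) `|f q|%:E)%E); last first.
    by apply: ge0_le_integral_subset.
  apply: le_trans (ltW pf).
  rewrite -mulrA EFinM lee_pmul2l ?lte_fin//.
  apply: le_trans (hvol_dball_ge_small p0 _); last first.
    by rewrite d0 (le_trans d96)// invf_le1// ler1n.
  rewrite lee_fin cE -(exprVn (768 * n)) -exprMn lerXn2r// ?nnegrE.
  - have n768 : 0 < 768 * n by rewrite mulr_gt0 ?ltr0n.
    by rewrite mulr_ge0 ?invr_ge0 ?(ltW n768) ?(ltW P0).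
  - by rewrite divr_ge0 ?mulr_ge0 ?(ltW n0) ?(ltW d0).
  (* Maximality of [m] gives [d > (96 * 2 ^+ m)^-1], so [(d / (4 * n)) ^+ k.+1] dominates;
     [768 = 96 * 4 * 2]. *)
  have -> : (768 * n)^-1 * (2 / 2 ^+ m) = (96 * 2 ^+ m)^-1 / (4 * n).
    by field; rewrite !lt0r_neq0.
  rewrite ler_pM2r ?invr_gt0 ?mulr_gt0//.
  rewrite -[leLHS]mul1r ler_pdivrMr ?mulr_gt0//.
  by move: m2; rewrite exprS => m2; lra.
have [a' [par aE]] : exists a' (par : bool), a = local_level par a'.
  exists (a %/ 2)%Z, ((a %% 2)%Z == 1); rewrite /local_level.
  have := divz_eq a 2; have := modz_ge0 a (isT : 2 != 0 :> int).
  have := ltz_pmod a (isT : 0 < 2 :> int).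
  move: (a %/ 2)%Z (a %% 2)%Z => x y; clear.
  by case: eqP => /= yE; lia.
have [m' [z' [mz' Qp']]] := maximal_cell_ex bad pQ.
exists (par, (ex, et)) => //; exists (a', (m', z')) => //.
rewrite /local_piece /= -aE; case: ifPn => // /asboolP.
by [].
Qed.

End local_cover.

(** * The weak-type inequality *)

Section weak_type.
Context {R : realType} (k : nat).
Hypothesis k_gt0 : (0 < k)%N.
Local Notation point := (hpoint R k.+1).
Local Notation H := (halfspace R k.+1).
Local Notation mu := (hvol R k.+1).

(** Clearing the inverse in the average uses that the volume of a ball is positive and finite. *)
Lemma hmaximal_gt (f : point -> R) (lam : R) p : H p ->
  (lam%:E < hmaximal f p)%E ->
  exists2 d, 0 < d &
    (lam%:E * mu (dball p d) < \int[mu]_(q in dball p d) `|f q|%:E)%E.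
Proof.
move=> p0 /ereal_sup_gt[_ [r r0 <-]] pr.
rewrite /= in_itv/= andbT in r0; exists (hradius r); first exact: hradius_gt0.
have <- : hball p r = dball p (hradius r).
  by apply/seteqP; split=> x; rewrite hballE.
have [rho dr _] := far_scale (hradius r).
have := hvol_dball_le_large k_gt0 p0 dr.
have := hvol_dball_gt0 p0 (hradius_gt0 r0).
have -> : dball p (hradius r) = hball p r.
  by apply/seteqP; split=> x; rewrite hballE.
move: pr; case: (hvol R k.+1 (hball p r)) => // b + b0 _.
rewrite lte_fin in b0; rewrite inver (negbTE (lt0r_neq0 b0)) => pr.
by rewrite -lte_pdivlMr// muleC.
Qed.

Lemma weighted_weak_type (s : R) : 1 < s -> exists2 C : R, 0 <= C &
  forall w : point -> R, measurable_fun H w -> (forall p, H p -> 0 <= w p) ->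
  forall f : point -> R, measurable_fun H f -> forall lam : R, 0 < lam ->
    (weight_of w [set p | H p /\ lam%:E < hmaximal f p] <=
     C%:E * lam^-1%:E *
     \int[mu]_(p in H) (`|f p|%:E * hmaximal_pow s w p))%E.
Proof.
move=> s1; have d01 : (0 < (96^-1 : R) <= 1).
  by rewrite invr_gt0 ltr0n invf_le1 ?ltr0n// ler1n.
have [c c0 cP] := far_set_cover k_gt0 s1 d01.
set c' : R := (768 * k.+1%:R) ^- k.+1.
have c'0 : 0 < c' by rewrite invr_gt0 exprn_gt0// mulr_gt0.
have /andP[r0 r1] := far_ratio_itv k_gt0 s1.
set C1 : R := 2 ^+ k * (2 * far_const k s / ((1 - far_ratio k s) * c)).
set C2 : R := 2 ^+ k.+2 * (local_const k s / c').
have C10 : 0 < C1.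
  by rewrite mulr_gt0 ?exprn_gt0// divr_gt0 ?mulr_gt0 ?far_const_gt0 ?subr_gt0.
have C20 : 0 < C2.
  by rewrite mulr_gt0 ?exprn_gt0// divr_gt0 ?local_const_gt0.
exists (2 * (C1 + C2)) => [|w mw w0 f mf lam lam0].
  by rewrite mulr_ge0// ltW// addr_gt0.
set L := (\int[mu]_(p in H) _)%E.
have L0 : (0 <= L)%E by apply: integral_ge0 => p _; rewrite mule_ge0 ?poweR_ge0.
pose Y (b : bool) : set point := if b then far_set s f lam c else local_set f lam c'.
have YH : \bigcup_b Y b `<=` H.
  by apply: bigcup_sub => -[] _; [exact: far_set_sub|exact: local_set_sub].
have w0Y x : (\bigcup_b Y b) x -> (0 <= (w x)%:E)%E.
  by move=> /YH Hx; rewrite lee_fin w0.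
have mY b : measurable (Y b).
  by case: b; [exact: measurable_far_set|exact: measurable_local_set].
have XY : [set p | H p /\ (lam%:E < hmaximal f p)%E] `<=` \bigcup_b Y b.
  move=> p [p0 /(hmaximal_gt p0)[d d0 pd]].
  have [dl|dl] := leP d 96^-1.
    exists false => //; apply: (@local_set_cover R k f lam c' lam0 p d) => //.
    by rewrite d0.
  by exists true => //; apply: (cP f lam mf lam0 p d) => //; exact: ltW.
(* The superlevel set is enclosed in a measurable union, one set for radii up to [96^-1] and one for
   larger radii. *)
apply: (@le_trans _ _ (\int[mu]_(p in \bigcup_b Y b) (w p)%:E)%E).
  by apply: ge0_le_integral_subset => // x /XY; exact: w0Y.
have -> : ((2 * (C1 + C2))%:E * lam^-1%:E * L =
    #|{: bool}|%:R%:E * ((C1 + C2)%:E * lam^-1%:E * L))%E.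
  by rewrite card_bool EFinM !muleA.
apply: integral_bigcup_finite => //.
- apply/measurable_EFinP; apply: measurable_funS mw => //.
  exact: measurable_halfspace.
- by rewrite !mule_ge0// lee_fin ?invr_ge0 ltW// addr_gt0.
have CL C : 0 < C -> C <= C1 + C2 ->
    (C%:E * lam^-1%:E * L <= (C1 + C2)%:E * lam^-1%:E * L)%E.
  move=> C0 CC; rewrite lee_wpmul2r// lee_wpmul2r ?lee_fin// invr_ge0 ltW//.
case; rewrite /Y.
- apply: le_trans (CL C1 C10 _); last by rewrite lerDl ltW.
  exact: far_set_weight.
- apply: le_trans (CL C2 C20 _); last by rewrite lerDr ltW.
  exact: local_set_weight.
Qed.

End weak_type.

Unset Implicit Arguments.

Theorem theorem1p1 (R : realType) (n : nat) (hn : (2 <= n)%N) :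
  exists C : R -> R,
    C s @[s --> 1^'+] --> +oo /\
    forall s : R, 1 < s ->
    forall w : hpoint R n -> R,
      measurable_fun (halfspace R n) w ->
      (forall p, halfspace R n p -> 0 <= w p) ->
    forall f : hpoint R n -> R,
      measurable_fun (halfspace R n) f ->
    forall lambda : R, 0 < lambda ->
      (weight_of w [set p | halfspace R n p /\ lambda%:E < hmaximal f p] <=
       (C s)%:E * (lambda^-1)%R%:E *
       \int[hvol R n]_(p in halfspace R n) (`|f p|%:E * hmaximal_pow s w p))%E.
Proof.
(* Writing the dimension as [k.+2] leaves [k.+1 > 0] horizontal coordinates. *)
case: n hn => [|[|k]]// _.
have /choice[C CP] : forall s : R, exists C : R, 0 <= C /\ (1 < s ->
    forall w : hpoint R k.+2 -> R, measurable_fun (halfspace R k.+2) w ->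
    (forall p, halfspace R k.+2 p -> 0 <= w p) ->
    forall f : hpoint R k.+2 -> R, measurable_fun (halfspace R k.+2) f ->
    forall lam : R, 0 < lam ->
    (weight_of w [set p | halfspace R k.+2 p /\ lam%:E < hmaximal f p] <=
     C%:E * lam^-1%:E * \int[hvol R k.+2]_(p in halfspace R k.+2)
       (`|f p|%:E * hmaximal_pow s w p))%E).
  move=> s; have [s1|s1] := ltP 1 s; last by exists 0.
  by have [C C0 CP] := weighted_weak_type (k := k.+1) isT s1; exists C.
(* Adding [(s - 1)^-1] forces divergence at [1], and a larger constant preserves the inequality. *)
exists (fun s => C s + (s - 1)^-1); split.
  apply/cvgryPge => A; near=> s.
  have s1 : 0 < s - 1 by rewrite subr_gt0; near: s; exact: nbhs_right_gt.
  have A0 : 0 < `|A| + 1 by rewrite ltr_wpDl.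
  apply: (@le_trans _ _ (s - 1)^-1); last by rewrite lerDr; have [] := CP s.
  apply: (@le_trans _ _ (`|A| + 1)).
    by rewrite (le_trans (ler_norm A))// lerDl.
  rewrite -[leLHS]invrK lef_pV2 ?posrE ?invr_gt0// lerBlDl ltW//.
  by near: s; apply: nbhs_right_lt; rewrite ltrDl invr_gt0.
move=> s s1 w mw w0 f mf lam lam0; have [C0 /(_ s1) CE] := CP s.
apply: (le_trans (CE w mw w0 f mf lam lam0)).
rewrite lee_wpmul2r//.
  by apply: integral_ge0 => p _; rewrite mule_ge0 ?poweR_ge0.
have li0 : 0 <= lam^-1 by rewrite invr_ge0 ltW.
by rewrite lee_wpmul2r ?lee_fin// lerDl invr_ge0 subr_ge0 ltW.
Unshelve. all: by end_near. Qed.
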